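(* Let $W$ be a $2m$-dimensional real linear symplectic space. Fix one of the two monotonicity types of rank $1$ curves (velocities nonnegative definite, or velocities nonpositive definite). There exist nonzero constants $C_1,\ldots,C_m$ and polynomials with real coefficients and without free term, depending only on $m$ and on the type, such that for every rank $1$ curve $\Lambda(\cdot)$ of constant finite weight in $L(W)$ of the fixed type, the tuple $\{\beta_{2i}(t)\}_{i=0}^{m-1}$ of its principal curvatures and the tuple $\{\lambda_i(t)\}_{i=1}^m$ of its modified principal curvatures are related by $$\lambda_i(t)=C_i\,\beta_{2i-2}(t)+\Phi_i(t),\qquad 1\le i\le m,$$ where each $\Phi_i(t)$ is the value of the corresponding polynomial at the functions $\beta_{2j}(t)$, $0\le j\le i-2$, and their derivatives (in particular $\Phi_1=0$).
   Context: $\sigma$ denotes the symplectic form of $W$. $L(W)$ is the set (manifold) of all Lagrangian subspaces of $W$, i.e. $m$-dimensional subspaces $\Lambda\subset W$ with $\sigma|_\Lambda=0$. Curves are smooth and defined on an interval. A basis $(E_1,\ldots,E_m,F_1,\ldots,F_m)$ of $W$ is called Darboux if $\sigma(E_i,E_j)=\sigma(F_i,F_j)=0$ and $\sigma(F_i,E_j)=\delta_{ij}$ for $1\le i,j\le m$. Velocity: the tangent space $T_\Lambda L(W)$ is identified with the space of quadratic forms on $\Lambda$ (equivalently, self-adjoint linear maps $\Lambda\to\Lambda^*$). For a smooth curve $\Lambda(\cdot)$ in $L(W)$ and $l\in\Lambda(\tau)$, choose a smooth curve $l(\cdot)$ in $W$ with $l(t)\in\Lambda(t)$ for all $t$ and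 $l(\tau)=l$; then $\dot\Lambda(\tau)(l)=\sigma(l'(\tau),l)$, which depends only on $l$ and the velocity of the curve at $\tau$. Rank: $\Lambda(\cdot)$ is a rank $1$ curve if for every $t$ the velocity $\dot\Lambda(t)$ has rank $1$ as a quadratic form on $\Lambda(t)$. Weight: given $\tau$, choose linear Darboux coordinates $W\cong\mathbb R^m\times\mathbb R^m$ such that $\Lambda(\tau)$ is transversal to $\{0\}\times\mathbb R^m$ (a Lagrangian subspace), so that for $t$ near $\tau$ one has $\Lambda(t)=\{(x,S_tx):x\in\mathbb R^m\}$ with $S_t$ a symmetric $m\times m$ matrix. The weight $k(\tau)$ at $\tau$ is the order of the zero at $t=\tau$ of $t\mapsto\det(S_t-S_\tau)$ (independent of coordinates). The curve has constant finite weight $k$ if $k(\tau)=k<\infty$ for all $\tau$. Principal curvatures: for transversal Lagrangian subspaces $\Lambda_0,\Lambda_1$ let $\mathcal B_{\Lambda_0,\Lambda_1}:\Lambda_1\to\Lambda_0^*$ be the isomorphism $v\mapsto\sigma(v,\cdot)|_{\Lambda_0}$. For $V_0\in T_{\Lambda_0}L(W)$, $V_1\in T_{\Lambda_1}L(W)$ (viewed as self-adjoint maps $\Lambda_i\to\Lambda_i^*$) the infinitesimal cross-ratio is the operator on $\Lambda_0$ given by $[V_0,V_1]_{\Lambda_0,\Lambda_1}=(\mathcal B_{\Lambda_1,\Lambda_0})^{-1}\circ V_1\circ(\mathcal B_{\Lambda_0,\Lambda_1})^{-1}\circ V_0$. For a curve of constant finite weight $k$ it is known that $$\mathrm{trace}\,[\dot\Lambda(t_0),\dot\Lambda(t_1)]_{\Lambda(t_0),\Lambda(t_1)}=-\frac{k}{(t_0-t_1)^2}-g_\Lambda(t_0,t_1)$$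 with $g_\Lambda$ smooth in a neighborhood of the diagonal; in linear Darboux coordinates $W\cong\mathbb R^m\times\mathbb R^m$ in which $\Lambda(t)=\{(x,S_tx):x\in\mathbb R^m\}$ with $S_t$ a symmetric $m\times m$ matrix for all $t$ near a given $\tau$, one has, for $t_0,t_1$ near $\tau$, $g_\Lambda(t_0,t_1)=\frac{\partial^2}{\partial t_0\partial t_1}\ln\left(\frac{\det(S_{t_0}-S_{t_1})}{(t_0-t_1)^k}\right)$. The functions $\beta_i(t)$ are defined by the formal Taylor expansion $g_\Lambda(t_0,t)\approx\sum_{i=0}^\infty\beta_i(t)(t_0-t)^i$ at $t_0=t$. For a rank $1$ curve and $0\le i\le m-1$, $\beta_{2i}(t)$ is called the $(i+1)$-th principal curvature. Modified principal curvatures: for a rank $1$ curve $\Lambda(\cdot)$ of constant finite weight there exists a smooth moving Darboux frame $(E_1(t),\ldots,E_m(t),F_1(t),\ldots,F_m(t))$, unique up to simultaneous change of sign of all its vectors, such that $\Lambda(t)=\mathrm{span}(E_1(t),\ldots,E_m(t))$ and, for some smooth functions $\lambda_1,\ldots,\lambda_m$, $$E_i'=E_{i+1}\ (1\le i\le m-1),\quad E_m'=\pm F_m,\quad F_1'=\lambda_mE_1,\quad F_i'=\lambda_{m-i+1}E_i-F_{i-1}\ (2\le i\le m),$$ with sign $+$ if $\dot\Lambda(t)$ is nonnegative definite and sign $-$ if $\dot\Lambda(t)$ is nonpositive definite. The function $\lambda_i(t)$ is called the $i$-th modified principal curvature. *)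

(* Defs.v *)
From HB Require Import structures.
From mathcomp Require Import all_boot all_order all_algebra.
From mathcomp Require Import sesquilinear.
From mathcomp Require Import all_classical all_reals all_analysis.
From mathcomp Require mpoly.

Set Implicit Arguments.
Unset Strict Implicit.
Unset Printing Implicit Defensive.

Import Order.TTheory GRing.Theory Num.Theory.
Import numFieldNormedType.Exports.

Local Open Scope classical_set_scope.
Local Open Scope ring_scope.

Section Smoothness.
Context {R : realType}.

Definition iter_derive {V U : normedModType R} (vs : seq V) (f : V -> U) :
  V -> U := foldr (fun v h => 'D_v h) f vs.

(* f is of class C^oo on some neighbourhood of x. *)
Definition smooth_at {V U : normedModType R} (f : V -> U) (x : V) : Prop :=
  \forall y \near x, forall vs : seq V, differentiable (iter_derive vs f) y.

(* A vectType carries no topology: curves in W are differentiated through the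
   linear functionals, which amounts to doing it coordinatewise in any basis. *)
Definition vsmooth_at {W : vectType R} (l : R -> W) (t : R) : Prop :=
  forall phi : 'Hom(W, R^o), smooth_at (fun s => phi (l s) : R) t.

Definition is_vderive {W : vectType R} (l : R -> W) (t : R) (d : W) : Prop :=
  forall phi : 'Hom(W, R^o), is_derive t 1 (fun s => phi (l s) : R) (phi d).

Definition zero_of_order (f : R -> R) (t : R) (k : nat) : Prop :=
  (forall j, (j < k)%N -> derive1n j f t = 0) /\ derive1n k f t != 0.

End Smoothness.

Section Symplectic.
Context {R : realType} {W : vectType R} (sigma : {skew_symmetric W}).

Definition symplectic_space (m : nat) : Prop :=
  nondegenerate sigma /\ \dim {:W} = m.*2.

Definition lagrangian (m : nat) (L : {vspace W}) : Prop :=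
  \dim L = m /\ {in L &, forall u v, sigma u v = 0}.

Definition darboux {m : nat} (E F : 'I_m -> W) : Prop :=
  [/\ basis_of {:W} ([seq E i | i : 'I_m] ++ [seq F i | i : 'I_m]),
      forall i j, sigma (E i) (E j) = 0,
      forall i j, sigma (F i) (F j) = 0 &
      forall i j, sigma (F i) (E j) = (i == j)%:R].

(* L = {(x, S x)} in the coordinates (x, y) |-> sum x_i E_i + sum y_i F_i *)
Definition is_graph {m : nat} (E F : 'I_m -> W) (S : 'M[R]_m)
    (L : {vspace W}) : Prop :=
  forall w : W, w \in L <->
    exists x : 'cV[R]_m,
      w = \sum_i x i 0 *: E i + \sum_i (S *m x) i 0 *: F i.

Definition lin_dual (L : {vspace W}) := 'Hom(subvs_of L, R^o).

(* Tangent vectors to the Lagrangian Grassmannian at L are represented by the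
   self-adjoint elements of this type. *)
Definition form_on (L : {vspace W}) := 'Hom(subvs_of L, lin_dual L).

Definition self_adjoint {L : {vspace W}} (V : form_on L) : Prop :=
  forall u v, V u v = V v u.

Definition pairing (L0 L1 : {vspace W}) : 'Hom(subvs_of L1, lin_dual L0) :=
  linfun (fun v : subvs_of L1 =>
    linfun (fun u : subvs_of L0 => sigma (vsval v) (vsval u) : R^o) : lin_dual L0).

(* For transversal Lagrangian L0 and L1 the two pairings are bijective, and
   then _^-1 is the inverse. *)
Definition cross_ratio {L0 L1 : {vspace W}} (V0 : form_on L0) (V1 : form_on L1)
    : 'End(subvs_of L0) :=
  ((pairing L1 L0)^-1 \o V1 \o (pairing L0 L1)^-1 \o V0)%VF.

Definition lftrace {U : vectType R} (f : 'End(U)) : R :=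
  \tr (passmx.mxof (vbasis {:U}) (vbasis {:U}) f).

End Symplectic.

(* A smooth curve defined on an interval I is given by a function on all of R
   which is a smooth curve on a neighbourhood of I; only its values on I are
   constrained below.  When I is open this is just a smooth curve on I.  When I
   contains an endpoint, the derivatives at that endpoint only depend on the
   values on I. *)

Section Curves.
Context {R : realType} {W : vectType R} (sigma : {skew_symmetric W}) {m : nat}.

Definition proper_interval (I : set R) : Prop :=
  is_interval I /\ I° !=set0.

Definition local_coordinates (Lam : R -> {vspace W}) (t : R)
    (E F : 'I_m -> W) (S : R -> 'M[R]_m) : Prop :=
  darboux sigma E F /\
  \forall s \near t, (S s)^T = S s /\ is_graph E F (S s) (Lam s).

Definition smooth_lagrangian_curve (I : set R) (Lam : R -> {vspace W}) : Prop :=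
  forall t, I t ->
    (\forall s \near t, lagrangian sigma m (Lam s)) /\
    exists (E F : 'I_m -> W) (S : R -> 'M[R]_m),
      local_coordinates Lam t E F S /\
      forall i j, smooth_at (fun s => S s i j) t.

Definition is_velocity (Lam : R -> {vspace W}) (t : R)
    (V : form_on (Lam t)) : Prop :=
  self_adjoint V /\
  forall u : subvs_of (Lam t), exists (l : R -> W) (d : W),
    [/\ vsmooth_at l t, \forall s \near t, l s \in Lam s, l t = vsval u,
        is_vderive l t d & V u u = sigma d (l t)].

(* A smooth Lagrangian curve has exactly one velocity at each point. *)
Definition velocity (Lam : R -> {vspace W}) (t : R) : form_on (Lam t) :=
  xget (0 : form_on (Lam t)) [set V | is_velocity V].

Definition rank1 (I : set R) (Lam : R -> {vspace W}) : Prop :=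
  forall t, I t -> \dim (limg (velocity Lam t)) = 1%N.

(* eps = false: nonnegative velocities; eps = true: nonpositive velocities *)
Definition monotone_type (eps : bool) (I : set R) (Lam : R -> {vspace W}) :
    Prop :=
  forall t, I t -> forall u, 0 <= (-1) ^+ eps * (velocity Lam t u u : R).

Definition weight_at (Lam : R -> {vspace W}) (t : R) (k : nat) : Prop :=
  exists (E F : 'I_m -> W) (S : R -> 'M[R]_m),
    local_coordinates Lam t E F S /\
    zero_of_order (fun s => \det (S s - S t)) t k.

Definition constant_weight (I : set R) (Lam : R -> {vspace W}) (k : nat) :
    Prop := forall t, I t -> weight_at Lam t k.

(* The defining property of g_Lam; the germ of g along the diagonal of I x I
   is determined by it on I x I. *)
Definition is_regular_part (I : set R) (Lam : R -> {vspace W}) (k : nat)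
    (g : R -> R -> R) : Prop :=
  forall t, I t ->
    smooth_at (fun p : R * R => g p.1 p.2) (t, t) /\
    \forall p \near (t, t), I p.1 -> I p.2 -> p.1 != p.2 ->
      (Lam p.1 :&: Lam p.2 = 0)%VS ->
      lftrace (cross_ratio sigma (velocity Lam p.1) (velocity Lam p.2)) =
        - (k%:R / (p.1 - p.2) ^+ 2) - g p.1 p.2.

(* beta g i t = beta_i(t) *)
Definition beta (g : R -> R -> R) (i : nat) (t : R) : R :=
  derive1n i (fun s => g s t) t / i`!%:R.

(* Indices are shifted: E i, F i, lam i stand for E_(i+1), F_(i+1),
   lambda_(i+1); rev_ord i is m - 1 - i. *)
Definition modified_curvatures (eps : bool) (I : set R)
    (Lam : R -> {vspace W}) (lam : 'I_m -> R -> R) : Prop :=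
  exists E F : 'I_m -> R -> W, forall t, I t ->
    [/\ forall i, [/\ vsmooth_at (E i) t, vsmooth_at (F i) t &
                      smooth_at (lam i) t],
        darboux sigma (E ^~ t) (F ^~ t),
        Lam t = <<[seq E i t | i : 'I_m]>>%VS,
        forall i j : 'I_m, j = i.+1 :> nat -> is_vderive (E i) t (E j t) &
    [/\ forall i : 'I_m, i.+1 = m ->
          is_vderive (E i) t ((-1) ^+ eps *: F i t),
        forall i : 'I_m, i = 0%N :> nat ->
          is_vderive (F i) t (lam (rev_ord i) t *: E i t) &
        forall i j : 'I_m, i = j.+1 :> nat ->
          is_vderive (F i) t (lam (rev_ord i) t *: E i t - F j t)]].

End Curves.

(* Real polynomials in the variables x_(j, d) with j < n and d < N, evaluated
   by giving x_(j, d) the value of the d-th derivative of f j at t. *)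

Definition diff_poly (R : realType) (n N : nat) :=
  mpoly.mpoly #|{: 'I_n * 'I_N}| R.

Definition no_free_term {R : realType} {n N : nat} (P : diff_poly R n N) :
  Prop := mpoly.mcoeff (mpoly.mnm0 (n := _)) P = 0.

Definition diff_eval {R : realType} {n N : nat} (P : diff_poly R n N)
    (f : nat -> R -> R) (t : R) : R :=
  mpoly.meval (fun v => let x : 'I_n * 'I_N := enum_val v in
                        derive1n x.2 (f x.1) t) P.

(* Main.v *)
Require Import Defs.
From HB Require Import structures.
From mathcomp Require Import all_boot all_order all_algebra.
From mathcomp Require Import sesquilinear.
From mathcomp Require Import all_classical all_reals all_analysis.
From mathcomp Require Import zify ring lra.
From mathcomp Require mpoly.
Import(canonicals) mpoly.
Import Order.TTheory GRing.Theory Num.Theory.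
Import numFieldNormedType.Exports.
Local Open Scope classical_set_scope.
Local Open Scope ring_scope.

Set Implicit Arguments.
Unset Strict Implicit.
Unset Printing Implicit Defensive.

(** Write [m = n + 1] and count indices from 0. On the interior of the interval
    fix [t] and let [h] tend to 0. The velocity in the frame is, up to sign, the
    square of the coordinate along [E_n] ([velocity_frame]). Both velocities have
    rank one, so the trace of the cross-ratio of the curve at [t + h] and [t] is
    minus the square of the last diagonal entry of the inverse of the Gram matrix
    [sigma (E_i(t + h)) (E_j(t))], up to signs ([lftrace_cross_ratio]). Hence
    [k + h^2 * g(t + h, t)] is [h^2] times that square, for small nonzero [h].

    The structure equations are a linear differential system. All derivatives of
    [E_i] at [t] are therefore combinations of the frame at [t] whose coefficients
    are universal differential polynomials in the [lambda_j] ([cf],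
    [is_derive_chain]). When [lambda_j] is given weight [2j + 2] and differentiation
    weight 1, they are homogeneous, and the entry [(i, j)] of the Gram matrix is
    [h^(2n+1-i-j)] times a series whose coefficient of [h^s] has weight [s]
    ([expands_gram]). These powers of [h] come out as a rescaling of rows and
    columns, so [k + h^2 * g(t + h, t)] is the square of a component of such a
    series of vectors, [nu] ([beta_nu]).

    The coefficient of [h^(2r+2)] is [beta_(2r)] and has weight [2r + 2]. For weight
    reasons it is a constant multiple [c_r * lambda_r] plus a differential
    polynomial without constant term in the [lambda_j], [j < r]
    ([nu_sq_expansion]). This system is triangular; if no [c_r] vanishes it can be
    solved for the [lambda_r] ([triangular_inversion]).

    It remains to see that [c_r] is nonzero. It is the first variation, with respect
    to a constant [lambda_r], of the expansion at the flat curve, where the [E_i] are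
    polynomial in time. By Duhamel's formula it is a nonzero multiple of the integral
    over [0, 1] of [D^l (x * p) * D^l ((x - 1) * p)] with [p = (x * (x - 1))^n] and
    [l = n - r]. For [l = 0] the integrand is negative. For [l > 0], the equation
    [x * (x - 1) * p' = n * (2x - 1) * p], differentiated [l] times, and integrations
    by parts turn the integral into [(n + 1 - l) * (1 - 2l)] times that of the square
    of [D^(l-1) p], which is negative ([pint_Xg_X1g], [rho_form_neq0]).

    At an endpoint of the interval the relation follows by continuity. *)

(** * Differential polynomials graded by weight *)

(** [DVar j d] stands for the [d]-th derivative of the [j]-th unknown function.
    These polynomials are kept as syntax so that total differentiation and
    substitution act on them without reference to any curve. *)
Inductive dexp (R : Type) : Type :=
| DCst of R
| DVar of nat & nat
| DAdd of dexp R & dexp R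
| DMul of dexp R & dexp R.
Arguments DVar {R}.

Section DifferentialPolynomials.
Context {R : realType}.
Implicit Types (e : dexp R) (y : nat -> nat -> R).

Fixpoint deval e y : R :=
  match e with
  | DCst c => c
  | DVar j d => y j d
  | DAdd a b => deval a y + deval b y
  | DMul a b => deval a y * deval b y
  end.

Fixpoint dtotal e : dexp R :=
  match e with
  | DCst c => DCst 0
  | DVar j d => DVar j d.+1
  | DAdd a b => DAdd (dtotal a) (dtotal b)
  | DMul a b => DAdd (DMul (dtotal a) b) (DMul a (dtotal b))
  end.

Fixpoint dsubst (s : nat -> nat -> dexp R) e : dexp R :=
  match e with
  | DCst c => DCst c
  | DVar j d => s j d
  | DAdd a b => DAdd (dsubst s a) (dsubst s b)
  | DMul a b => DMul (dsubst s a) (dsubst s b)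
  end.

Fixpoint dvars_lt n e : bool :=
  match e with
  | DCst c => true
  | DVar j d => (j < n)%N
  | DAdd a b | DMul a b => dvars_lt n a && dvars_lt n b
  end.

Fixpoint dorder e : nat :=
  match e with
  | DCst c => 0
  | DVar j d => d.+1
  | DAdd a b | DMul a b => maxn (dorder a) (dorder b)
  end.

Lemma deval_subst s e y :
  deval (dsubst s e) y = deval e (fun j d => deval (s j d) y).
Proof. by elim: e => //= a -> b ->. Qed.

Lemma eq_deval e n y y' : dvars_lt n e ->
  (forall j d, (j < n)%N -> y j d = y' j d) -> deval e y = deval e y'.
Proof.
move=> + yy'; elim: e => [//|j d|a IHa b IHb|a IHa b IHb] /=; first exact: yy'.
1,2: by move=> /andP[/IHa -> /IHb ->].
Qed.

Lemma dvars_lt_subst n r s e : dvars_lt r e ->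
  (forall j d, (j < r)%N -> dvars_lt n (s j d)) -> dvars_lt n (dsubst s e).
Proof.
move=> + hs; elim: e => [//|j d|a IHa b IHb|a IHa b IHb] /=; first exact: hs.
1,2: by move=> /andP[/IHa -> /IHb ->].
Qed.

Lemma dvars_ltW n r e : (n <= r)%N -> dvars_lt n e -> dvars_lt r e.
Proof.
move=> nr; elim: e => [//|j d|a IHa b IHb|a IHa b IHb] /=; first by move/leq_trans; apply.
1,2: by move=> /andP[/IHa -> /IHb ->].
Qed.

Lemma dvars_lt_total n e k : dvars_lt n e -> dvars_lt n (iter k dtotal e).
Proof.
move=> ne; elim: k => //= k; move: (iter _ _ _) => {ne}e.
elim: e => //= [a IHa b IHb|a IHa b IHb] /andP[na nb].
  by rewrite IHa ?IHb.
by rewrite IHa ?IHb ?na ?nb.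
Qed.

(** A jet without derivatives is that of constant functions. *)
Lemma deval_total_cst e y : (forall j d, y j d.+1 = 0) -> deval (dtotal e) y = 0.
Proof.
move=> y0; elim: e => //= [a -> b ->|a -> b ->]; first by rewrite addr0.
by rewrite mul0r mulr0 addr0.
Qed.

Definition jet (f : nat -> R -> R) (t : R) : nat -> nat -> R :=
  fun j d => derive1n d (f j) t.

Lemma is_derive_deval e n f t :
  (forall j d, (j < n)%N -> derivable (derive1n d (f j)) t 1) ->
  dvars_lt n e ->
  is_derive t 1 (fun s => deval e (jet f s)) (deval (dtotal e) (jet f t)).
Proof.
move=> df; elim: e => [c|j d|a IHa b IHb|a IHa b IHb] /=.
- move=> _; exact: is_derive_cst.
- move=> jn; apply: DeriveDef; first exact: df.
  by rewrite -derive1E.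
- move=> /andP[/IHa ? /IHb ?]; exact: is_deriveD.
- move=> /andP[/IHa ? /IHb ?].
  apply: is_derive_eq; rewrite /GRing.scale /=; ring.
Qed.

(** The [j]-th function has weight [2j+2], the exponent by which [lambda_j]
    scales under a linear change of time, and differentiation adds one. Weights
    are integers, and not natural numbers, so that [homog_cf] below needs no
    case distinction: in negative weight only the zero polynomial remains. *)
Inductive homog : dexp R -> int -> Prop :=
| homog0 w : homog (DCst 0) w
| homogC c : homog (DCst c) 0
| homogV j d : homog (DVar j d) (j.*2.+2 + d)%:Z
| homogD a b w of homog a w & homog b w : homog (DAdd a b) w
| homogM a b v w of homog a v & homog b w : homog (DMul a b) (v + w).

Lemma homog_total e w : homog e w -> homog (dtotal e) (w + 1).
Proof.
elim=> //= [w'|c|j d|a b w' _ ? _ ?|a b v w' ? ? ? ?]; try exact: homog0.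
- have -> : (j.*2.+2 + d)%:Z + 1 = (j.*2.+2 + d.+1)%:Z by lia.
  exact: homogV.
- exact: homogD.
- apply: homogD; first by rewrite addrAC; exact: homogM.
  by rewrite -addrA; exact: homogM.
Qed.

Lemma homog_neg e w y : homog e w -> w < 0 -> deval e y = 0.
Proof.
elim=> //= [a b w' _ IHa _ IHb w0|a b v w' _ IHa _ IHb w0].
  by rewrite IHa ?IHb ?addr0.
have [v0|v0] := ltP v 0; first by rewrite IHa ?mul0r.
by rewrite IHb ?mulr0//; lia.
Qed.

Lemma homog_wt0 e w y y' : homog e w -> w = 0 -> deval e y = deval e y'.
Proof.
elim=> //= [a b w' _ IHa _ IHb w0|a b v w' ha IHa hb IHb w0].
  by rewrite IHa ?IHb.
have [v0|v0|v0] := ltgtP v 0; first by rewrite !(homog_neg _ ha) ?mul0r.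
  by rewrite !(homog_neg _ hb) ?mulr0//; lia.
by rewrite IHa ?IHb//; lia.
Qed.

(** Evaluation at this jet reads off the coefficient with which the
    undifferentiated [r]-th function occurs alone. *)
Definition djet (r j d : nat) : R := ((j == r) && (d == 0))%:R.

(** A monomial of positive weight below [2r+2] contains a variable other than
    [DVar r 0], since that one is too heavy. *)
Lemma homog_djet0 e w r : homog e w -> 0 < w -> w < r.*2.+2%:Z ->
  deval e (djet r) = 0.
Proof.
elim=> //= [j d|a b w' _ IHa _ IHb w0 wr|a b v w' ha IHa hb IHb w0 wr].
- move=> _ jr; rewrite /djet; case: eqP => //= jr'; case: eqP => //= d0.
  by lia.
- by rewrite IHa ?IHb ?addr0.
- have [v0|v0|v0] := ltgtP v 0; first by rewrite !(homog_neg _ ha) ?mul0r.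
    have [v1|v1] := ltP v r.*2.+2%:Z; first by rewrite IHa ?mul0r.
    by rewrite !(homog_neg _ hb) ?mulr0//; lia.
  by rewrite IHb ?mulr0//; lia.
Qed.

Definition dtrunc r e := dsubst (fun j d => if (j < r)%N then DVar j d else DCst 0) e.

Lemma homog_trunc e w r : homog e w -> homog (dtrunc r e) w.
Proof.
rewrite /dtrunc; elim=> /= [w'|c|j d|a b w' _ ? _ ?|a b v w' _ ? _ ?].
- exact: homog0.
- exact: homogC.
- case: ifP => _; [exact: homogV|exact: homog0].
- exact: homogD.
- exact: homogM.
Qed.

Lemma dvars_lt_trunc r e : dvars_lt r (dtrunc r e).
Proof.
rewrite /dtrunc; elim: e => //= [j d|a -> b ->//|a -> b ->//].
by case: ifP.
Qed.

(** In weight [2r+2] the top variable [DVar r 0] already has full weight, so it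
    can only occur linearly and with a constant coefficient; the variables of
    higher index do not occur. *)
Lemma homog_top e w r y : homog e w -> w <= r.*2.+2%:Z ->
  deval e y = deval (dtrunc r e) y
              + (w == r.*2.+2%:Z)%:R * deval e (djet r) * y r 0.
Proof.
elim=> [w'|c|j d|a b w' _ IHa _ IHb wr|a b v w' ha IHa hb IHb wr].
- by rewrite /= mulr0 mul0r addr0.
- by rewrite /= mul0r mul0r addr0.
- move=> jr; rewrite /dtrunc /= /djet; case: ifP => jr'.
    by rewrite (_ : j == r = false) ?mulr0 ?mul0r ?addr0//; lia.
  have [-> ->] : j = r /\ d = 0%N by lia.
  by rewrite !eqxx addn0 eqxx /= !mul1r add0r.
- rewrite [dtrunc r (DAdd a b)]/dtrunc /= -/(dtrunc r a) -/(dtrunc r b) IHa// IHb//; ring.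
- rewrite [dtrunc r (DMul a b)]/dtrunc /= -/(dtrunc r a) -/(dtrunc r b).
  have [v0|v0|v0] := ltgtP v 0.
  + by rewrite !(homog_neg _ ha)// !(homog_neg _ (homog_trunc r ha))//; ring.
  + have [w0|w0|w0] := ltgtP w' 0.
    * by rewrite !(homog_neg _ hb)// !(homog_neg _ (homog_trunc r hb))//; ring.
    * rewrite IHa ?IHb; [|lia|lia].
      rewrite (_ : v == _ = false); last lia.
      rewrite (_ : w' == _ = false); last lia.
      rewrite (homog_djet0 ha)//; last lia.
      by rewrite !mulr0n !(mul0r, mulr0, addr0).
    * rewrite IHa ?IHb; [|lia|lia].
      rewrite w0 addr0 (_ : 0 == r.*2.+2%:Z = false); last lia.
      have := homog_wt0 y (djet r) hb w0; rewrite IHb//; last lia.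
      rewrite w0 (_ : 0 == r.*2.+2%:Z = false); last lia.
      rewrite !mulr0n !mul0r !addr0 => ->; ring.
  + rewrite IHa ?IHb; [|lia|lia].
    rewrite v0 add0r (_ : 0 == r.*2.+2%:Z = false); last lia.
    have := homog_wt0 y (djet r) ha v0; rewrite IHa//; last lia.
    rewrite v0 (_ : 0 == r.*2.+2%:Z = false); last lia.
    rewrite !mulr0n !mul0r !addr0 => ->; ring.
Qed.

Lemma homog_deval0 e w : homog e w -> 0 < w -> deval e (fun _ _ => 0) = 0.
Proof.
elim=> //= [a b w' _ IHa _ IHb w0|a b v w' ha IHa hb IHb w0].
  by rewrite IHa ?IHb ?addr0.
have [v0|v0] := ltP 0 v; first by rewrite IHa ?mul0r.
by rewrite IHb ?mulr0//; lia.
Qed.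

(** ** Conversion to multivariate polynomials *)

Definition dmvar (n N j d : nat) : diff_poly R n N :=
  match insub j, insub d with
  | Some j', Some d' => mpoly.mpolyX R (mpoly.mnm1 (enum_rank (j', d') : 'I_#|{: 'I_n * 'I_N}|))
  | _, _ => 0
  end.

Fixpoint dmpoly n N e : diff_poly R n N :=
  match e with
  | DCst c => mpoly.mpolyC _ c
  | DVar j d => dmvar n N j d
  | DAdd a b => dmpoly n N a + dmpoly n N b
  | DMul a b => dmpoly n N a * dmpoly n N b
  end.

Lemma diff_eval_dmpoly n N e f t : dvars_lt n e -> (dorder e <= N)%N ->
  diff_eval (dmpoly n N e) f t = deval e (jet f t).
Proof.
rewrite /diff_eval; elim: e => [c|j d|a IHa b IHb|a IHa b IHb] /=.
- by rewrite mpoly.mevalC.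
- move=> jn dN; rewrite /dmvar !insubT /=.
  by rewrite mpoly.mevalXU enum_rankK.
- rewrite geq_max => /andP[? ?] /andP[? ?].
  by rewrite mpoly.mevalD IHa// IHb.
- rewrite geq_max => /andP[? ?] /andP[? ?].
  by rewrite mpoly.mevalM IHa// IHb.
Qed.

Lemma no_free_term_dmpoly n N e :
  deval e (fun _ _ => 0) = 0 -> no_free_term (dmpoly n N e).
Proof.
rewrite /no_free_term => <-; elim: e => [c|j d|a IHa b IHb|a IHa b IHb] /=.
- by rewrite mpoly.mcoeffC eqxx mulr1.
- rewrite /dmvar; case: insub => [j'|]; last exact: mpoly.mcoeff0.
  case: insub => [d'|]; last exact: mpoly.mcoeff0.
  by rewrite mpoly.mcoeffX mpoly.mnm1_eq0.
- by rewrite mpoly.mcoeffD IHa IHb.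
- by rewrite -IHa -IHb; exact: (rmorphM (mpoly.mcoeff _)).
Qed.

End DifferentialPolynomials.
(** * The leading coefficients do not vanish *)

Section PolynomialIntegral.
Context {R : realType}.
Implicit Types p q f g : {poly R}.

(** The integral of a polynomial over [0, 1], as a linear form on coefficients. *)
Definition pint p : R := \sum_(i < size p) p`_i / i.+1%:R.

Lemma pint_wide k p : (size p <= k)%N -> pint p = \sum_(i < k) p`_i / i.+1%:R.
Proof.
move=> pk; rewrite /pint (big_ord_widen k (fun i => p`_i / i.+1%:R)) // big_mkcond.
apply: eq_bigr => i _; case: ltnP => // /(nth_default 0) ->.
by rewrite mul0r.
Qed.

Lemma pintD p q : pint (p + q) = pint p + pint q.
Proof.
pose k := maxn (size p) (size q).
rewrite (@pint_wide k (p + q)); last exact: size_polyD.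
rewrite (@pint_wide k p) ?leq_maxl// (@pint_wide k q) ?leq_maxr// -big_split /=.
by apply: eq_bigr => i _; rewrite coefD mulrDl.
Qed.

Lemma pintZ a p : pint (a *: p) = a * pint p.
Proof.
rewrite (@pint_wide (size p) (a *: p)) ?size_scale_leq// mulr_sumr.
by apply: eq_bigr => i _; rewrite coefZ mulrA.
Qed.

Lemma pintMn p k : pint (p *+ k) = pint p *+ k.
Proof. by rewrite -scaler_nat pintZ mulr_natl. Qed.

Lemma pint0 : pint 0 = 0.
Proof. by rewrite -(scale0r (0 : {poly R})) pintZ mul0r. Qed.

Lemma pint_sum (J : finType) (F : J -> {poly R}) :
  pint (\sum_j F j) = \sum_j pint (F j).
Proof. by elim/big_rec2: _ => [|j a b _ <-]; [exact: pint0|exact: pintD]. Qed.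

Lemma pint_deriv p : pint p^`() = p.[1] - p.[0].
Proof.
rewrite (@pint_wide (size p).-1) ?size_poly//.
have -> : p.[1] = \sum_(i < size p) p`_i.
  by rewrite horner_coef; apply: eq_bigr => i _; rewrite expr1n mulr1.
rewrite horner_coef0; case: (size p) (@nth_default _ 0 p) => [->//|k _].
  by rewrite !big_ord0 subrr.
rewrite big_ord_recl /= addrAC subrr add0r; apply: eq_bigr => i _.
by rewrite coef_deriv -[X in X / _]mulr_natr mulfK ?pnatr_eq0.
Qed.

Lemma pint_gt0 p : (forall x, 0 <= x <= 1 -> 0 <= p.[x]) -> p != 0 -> 0 < pint p.
Proof.
move=> p0 pN0.
pose F := \poly_(i < (size p).+1) (p`_i.-1 / i%:R).
have dF : F^`() = p.
  apply/polyP => i; rewrite coef_deriv coef_poly ltnS; case: ltnP => ip /=.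
    by rewrite -[LHS]mulr_natr divfK ?pnatr_eq0.
  by rewrite nth_default// mul0rn.
have F_le a b : 0 <= a -> a <= b -> b <= 1 -> F.[a] <= F.[b].
  move=> a0 ab b1.
  have [||c] := @MVT_segment R (horner F) (horner p) a b ab.
  - by move=> x _; rewrite -dF; exact: is_derive_poly.
  - by apply: continuous_subspaceT => x; exact: continuous_horner.
  rewrite in_itv /= => /andP[ac cb] Fba.
  rewrite -subr_ge0 Fba mulr_ge0 ?subr_ge0// p0//.
  by rewrite (le_trans a0 ac) (le_trans cb b1).
rewrite -dF pint_deriv subr_gt0 lt_neqAle F_le// andbT.
apply: contra pN0 => /eqP F01; rewrite -dF.
(* A monotone primitive with equal values at 0 and 1 is constant on [0, 1]; being
   a polynomial it is constant, since it takes one value at all [1 / (i + 1)]. *)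
suff -> : F = (F.[0])%:P by rewrite derivC.
apply/eqP; rewrite -subr_eq0; apply/eqP.
pose q := F - (F.[0])%:P.
pose s : seq R := [seq (i.+1)%:R^-1 | i <- iota 0 (size q)].
apply: (@roots_geq_poly_eq0 _ q s); last by rewrite size_map size_iota.
- apply/allP => x /mapP[i _ ->]; rewrite /root /q hornerD hornerN hornerC subr_eq0.
  have i0 : 0 <= (i.+1%:R : R)^-1 by rewrite invr_ge0 ler0n.
  have i1 : (i.+1%:R : R)^-1 <= 1 by rewrite invf_le1 ?ltr0n// ler1n.
  by rewrite eq_le (F_le 0)// andbT F01 F_le.
- rewrite map_inj_uniq ?iota_uniq// => i j /invr_inj /eqP.
  by rewrite eqr_nat eqSS => /eqP.
Qed.

(** Euler's beta integral; the induction integrates the derivative of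
    ['X^(a+1) * (1 - 'X) ^+ (b+1)], which vanishes at both ends. *)
Lemma pint_beta a b :
  pint ('X^a * (1 - 'X) ^+ b) = a`!%:R * b`!%:R / (a + b).+1`!%:R.
Proof.
elim: b a => [|b IHb] a.
  rewrite expr0 mulr1 fact0 mulr1 addn0 factS natrM invfM mulrCA mulfV ?mulr1.
    rewrite (@pint_wide a.+1) ?size_polyXn// big_ord_recr /= big1 ?add0r.
      by rewrite coefXn eqxx mul1r.
    by move=> i _; rewrite coefXn ltn_eqF ?mul0r.
  by rewrite pnatr_eq0 -lt0n fact_gt0.
have d1 : (1 - 'X : {poly R})^`() = - 1.
  by rewrite derivB derivX -polyC1 derivC sub0r.
have := pint_deriv ('X^(a.+1) * (1 - 'X) ^+ b.+1).
rewrite derivM derivXn deriv_exp d1 /=.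
rewrite !hornerE /= !expr0n /= subrr expr0n /= mulr0 mul0r subrr.
have -> : 'X^a *+ a.+1 * (1 - 'X) ^+ b.+1
    + 'X^(a.+1) * ((- 1) * (1 - 'X) ^+ b *+ b.+1)
  = a.+1%:R *: ('X^a * (1 - 'X) ^+ b.+1)
    + - b.+1%:R *: ('X^(a.+1) * (1 - 'X) ^+ b) :> {poly R}.
  by rewrite mulN1r mulNrn mulrN scaleNr !scaler_nat mulrnAl mulrnAr.
rewrite pintD !pintZ IHb mulNr => /eqP; rewrite subr_eq0 => /eqP.
move/(congr1 (fun x => a.+1%:R^-1 * x)); rewrite mulKf ?pnatr_eq0// => ->.
rewrite addSn -addnS !factS !natrM.
have := fact_gt0 (a + b.+1); rewrite -(ltr0n R) => /lt0r_neq0 ?.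
field.
have a0 := ler0n R a; have b0 := ler0n R b.
by apply/and3P; split => //; apply: lt0r_neq0; lra.
Qed.

End PolynomialIntegral.

Section Hilbert.
Context {R : realType}.
Implicit Types p q f g : {poly R}.

(** Read off from the Taylor expansion of [p] at [c]. *)
Lemma dvdp_exp_derivn p c k : (forall l, (l < k)%N -> p^`(l).[c] = 0) ->
  (('X - c%:P) ^+ k %| p)%R.
Proof.
move=> p0.
have -> : p = \sum_(i < size p) (p^`N(i).[c])%:P * ('X - c%:P) ^+ i.
  have := @nderiv_taylor _ (p^:P) c%:P ('X - c%:P) (mulrC _ _).
  rewrite addrC subrK size_map_polyC -/(p \Po 'X) comp_polyXr => {1}->.
  apply: eq_bigr => i _; congr (_ * _).
  by rewrite nderivn_map horner_map.
elim/big_rec: _ => [|i q _ IHq]; first exact: dvdp0.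
rewrite dvdp_add// {IHq}.
have [ik|ki] := ltnP i k; last by rewrite dvdp_mull// dvdp_exp2l.
have := p0 i ik; rewrite nderivn_def hornerMn => /eqP.
rewrite mulrn_eq0 -leqn0 leqNgt fact_gt0 /= => /eqP ->.
by rewrite polyC0 mul0r dvdp0.
Qed.

Lemma derivn_root_lt p c k n : (('X - c%:P) ^+ n %| p)%R -> (k < n)%N ->
  p^`(k).[c] = 0.
Proof.
move=> pn kn.
suff : (('X - c%:P) ^+ (n - k) %| p^`(k))%R.
  move=> /dvdpP[q ->]; rewrite hornerM horner_exp hornerXsubC subrr expr0n.
  by rewrite (_ : _ == _ = false) ?mulr0//; lia.
elim: k kn => [_|k IHk kn]; first by rewrite subn0 derivn0.
have /dvdpP[q dq] := IHk (ltnW kn); rewrite derivnS dq derivM dvdp_add//.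
  by rewrite dvdp_mull// dvdp_exp2l//; lia.
rewrite deriv_exp derivXsubC mul1r dvdp_mull//.
by rewrite -mulr_natr dvdp_mulr// dvdp_exp2l//; lia.
Qed.

(** The divided power of the variable. *)
Definition dpow k : {poly R} := k`!%:R^-1 *: 'X^k.

Lemma derivn_dpow l k : (l <= k)%N -> (dpow k)^`(l) = dpow (k - l).
Proof.
move=> lk; rewrite /dpow derivnZ derivnXn -scalerMnr scalerMnl; congr (_ *: _).
have := ffact_fact lk => /(congr1 (fun n => n%:R : R)); rewrite natrM => <-.
have := fact_gt0 (k - l); rewrite -(ltr0n R) => /lt0r_neq0 ?.
have : (0 < k ^_ l)%N by rewrite ffact_gt0.
rewrite -(ltr0n R) => /lt0r_neq0 ?.
by rewrite -[LHS]mulr_natr invfM mulrAC mulVf ?mul1r.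
Qed.

Lemma horner1_dpow k : (dpow k).[1] = k`!%:R^-1.
Proof. by rewrite /dpow hornerZ hornerXn expr1n mulr1. Qed.

Definition quad : {poly R} := 'X * ('X - 1%:P).

Variable n : nat.

(** For [s = 0] this is, up to signs, the Gram matrix of the flat curve (all
    [lambda] zero) after division by powers of [h]; for [s = 2r + 2] it is the
    first variation of that matrix with respect to [lambda_r], up to signs. *)
Definition fhilb (s : nat) : 'M[R]_n.+1 :=
  \matrix_(i, j) ((n.*2.+1 + s - i - j)`!)%:R^-1.

(** A row vector is read as a polynomial vanishing to order [n+1] at [0]; its
    product with [fhilb 0] is then the list of derivatives of this polynomial
    at [1], which makes the linear algebra of [fhilb 0] an interpolation
    problem. *)
Definition rowpoly (v : 'rV[R]_n.+1) : {poly R} :=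
  \sum_i v 0 i *: dpow (n.*2.+1 - i).

Lemma derivn_rowpoly v l : (l <= n)%N ->
  (rowpoly v)^`(l) = \sum_i v 0 i *: dpow (n.*2.+1 - i - l).
Proof.
move=> ln; rewrite /rowpoly linear_sum /=.
apply: eq_bigr => i _; rewrite derivnZ derivn_dpow//.
by have := ltn_ord i; lia.
Qed.

Lemma rowpoly_derivn1 v (l : 'I_n.+1) :
  (rowpoly v)^`(l).[1] = (v *m fhilb 0) 0 l.
Proof.
rewrite derivn_rowpoly; last by rewrite -ltnS.
rewrite horner_sum mxE; apply: eq_bigr => i _.
by rewrite hornerZ horner1_dpow !mxE addn0.
Qed.

Lemma coef_rowpoly v (i : 'I_n.+1) :
  (rowpoly v)`_(n.*2.+1 - i) = v 0 i / (n.*2.+1 - i)`!%:R.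
Proof.
rewrite /rowpoly coef_sum (bigD1 i)//= big1 ?addr0.
  by rewrite coefZ /dpow coefZ coefXn eqxx mulr1.
move=> j ji; rewrite coefZ /dpow coefZ coefXn.
rewrite (_ : _ == _ = false) ?mulr0//.
apply: contra_neqF ji => /eqP ij; apply: val_inj => /=.
by have := ltn_ord i; have := ltn_ord j; lia.
Qed.

Lemma size_rowpoly v : (size (rowpoly v) <= n.+1.*2)%N.
Proof.
apply: (leq_trans (size_sum _ _ _)); apply/bigmax_leqP => i _.
apply: (leq_trans (size_scale_leq _ _)).
apply: (leq_trans (size_scale_leq _ _)); rewrite size_polyXn; lia.
Qed.

Lemma dvdp_rowpoly v k : (k <= n.+1)%N ->
  (forall l : 'I_n.+1, (l < k)%N -> (v *m fhilb 0) 0 l = 0) ->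
  ('X^(n.+1) * ('X - 1%:P) ^+ k %| rowpoly v)%R.
Proof.
move=> kn v0; rewrite Gauss_dvdp.
  apply/andP; split; last first.
    apply: dvdp_exp_derivn => l lk.
    have ln : (l < n.+1)%N by apply: leq_trans lk kn.
    by rewrite (rowpoly_derivn1 v (Ordinal ln)) v0.
  rewrite /rowpoly; elim/big_rec: _ => [|i q _ IHq]; first exact: dvdp0.
  rewrite dvdp_add// -mul_polyC dvdp_mull// /dpow -mul_polyC dvdp_mull//.
  by apply: dvdp_exp2l; have := ltn_ord i; lia.
apply/coprimep_expl/coprimep_expr.
have := @coprimep_XsubC2 R 0 1; rewrite polyC0 !subr0; apply.
exact: oner_neq0.
Qed.

(** A row in the kernel is a polynomial of degree at most [2n+1] with a zero of
    order [n+1] at [0] and another at [1]. *)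
Lemma fhilb_unit : fhilb 0 \in unitmx.
Proof.
rewrite -row_free_unit -kermx_eq0; apply/eqP/row_matrixP => i; rewrite row0.
set v := row i _.
have v0 : v *m fhilb 0 = 0.
  by apply/sub_kermxP; rewrite /v row_sub.
have /dvdp_leq : ('X^(n.+1) * ('X - 1%:P) ^+ n.+1 %| rowpoly v)%R.
  by apply: dvdp_rowpoly => // l _; rewrite v0 mxE.
have : rowpoly v = 0 \/ rowpoly v != 0.
  by have [->|] := eqVneq (rowpoly v) 0; [left|right].
case=> [p0 _|p0 /(_ p0)]; last first.
  rewrite size_monicM ?monicXn ?expf_neq0 ?polyXsubC_eq0//.
  rewrite size_polyXn size_exp_XsubC => /leq_trans /(_ (size_rowpoly v)); lia.
apply/rowP => j; rewrite [RHS]mxE; have := coef_rowpoly v j; rewrite p0 coef0.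
move/esym/eqP; rewrite mulf_eq0 invr_eq0 pnatr_eq0 -leqn0 leqNgt fact_gt0 orbF.
by move/eqP.
Qed.

Definition rho : 'rV[R]_n.+1 := delta_mx 0 ord_max *m invmx (fhilb 0).

Lemma rhoK : rho *m fhilb 0 = delta_mx 0 ord_max.
Proof. by rewrite /rho mulmxKV// fhilb_unit. Qed.

Definition qpow : {poly R} := quad ^+ n.

(** The interpolation conditions leave zeros of orders [n+1] at [0] and [n] at
    [1], which exhausts the degree. *)
Lemma rowpoly_rho : exists2 c, c != 0 & rowpoly rho = c *: ('X * qpow).
Proof.
have /dvdpP[q dq] : ('X^(n.+1) * ('X - 1%:P) ^+ n %| rowpoly rho)%R.
  apply: dvdp_rowpoly => // l ln; rewrite rhoK mxE eqxx /=.
  by rewrite (_ : _ == _ = false)// -val_eqE /=; lia.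
have q0 : q != 0.
  apply/eqP => q0; have : rowpoly rho = 0 by rewrite dq q0 mul0r.
  move=> p0; have := rowpoly_derivn1 rho ord_max; rewrite p0 rhoK mxE !eqxx /=.
  rewrite (_ : derivn n 0 = 0) ?horner0; last exact: linear0.
  by move/esym/eqP; rewrite oner_eq0.
have /size_poly1P[c c0 qc] : size q == 1%N.
  have := size_rowpoly rho; rewrite dq size_Mmonic//; last first.
    by rewrite monicMl ?monicXn// monic_exp// monicXsubC.
  rewrite size_monicM ?monicXn ?expf_neq0 ?polyXsubC_eq0//.
  rewrite size_polyXn size_exp_XsubC; have := size_poly_eq0 q.
  rewrite (negbTE q0); case: (size q) => [|[|k]] // _; lia.
exists c => //; rewrite dq qc mul_polyC /qpow /quad exprMn exprS; congr (_ *: _).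
by rewrite mulrA.
Qed.

Lemma rho_last_neq0 : rho 0 ord_max != 0.
Proof.
have [c c0 rhoE] := rowpoly_rho.
have := coef_rowpoly rho ord_max; rewrite rhoE /= (_ : n.*2.+1 - n = n.+1)%N; last lia.
rewrite coefZ coefXM /= /qpow /quad exprMn coefXnM ltnn subnn.
rewrite -horner_coef0 horner_exp hornerXsubC sub0r.
move=> rhoE'; apply/eqP => r0; move: rhoE'; rewrite r0 mul0r => /eqP.
by rewrite mulf_eq0 (negbTE c0) expf_eq0 oppr_eq0 oner_eq0 andbF.
Qed.

End Hilbert.

(** Lets an equation be deduced from another one by [ring]. *)
Lemma eq_of_sub_eq (A : zmodType) (a b c d : A) : a = b -> d - c = b - a -> c = d.
Proof. by move=> -> /eqP; rewrite subrr subr_eq0 => /eqP. Qed.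

Section Nonvanishing.
Context {R : realType}.
Variable n : nat.
Implicit Types p q f g : {poly R}.

Local Notation g := (@qpow R n).
Local Notation Dg k := (g^`(k)).

Let quad' : {poly R} := 'X + ('X - 1%:P).

Let dq0 : (@quad R)^`() = quad'.
Proof. by rewrite /quad derivM derivXsubC derivX mul1r mulr1 addrC. Qed.

Let dq1 : quad'^`() = 1 *+ 2 :> {poly R}.
Proof. by rewrite /quad' derivD derivX derivXsubC. Qed.

Let deriv_Dg k : (Dg k)^`() = Dg k.+1.
Proof. by rewrite derivnS. Qed.

Fact qpow_ode_step (A : comNzRingType) (k : nat) (q t a3 a2 a1 a0 : A) :
  t * a2 + q * a3 + (1 *+ 2 * a1 + t * a2) *+ k.+1 + a1 *+ (k.+1 * k)
    = (1 *+ 2 * a1 + t * a2) *+ n + a1 *+ (2 * n * k.+1) ->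
  q * a3 + t * a2 *+ k.+2 + a1 *+ (k.+2 * k.+1)
    = t * a2 *+ n + a1 *+ (2 * n * k.+2).
Proof. by move=> E; apply: (eq_of_sub_eq E); ring. Qed.

(** The first-order equation [q0 * g' = n * q0' * g] of the power [g = q0 ^+ n],
    with [q0 = 'X * ('X - 1)], differentiated [k+1] times. *)
Lemma qpow_ode k :
  quad * Dg k.+2 + quad' * Dg k.+1 *+ k.+1 + Dg k *+ (k.+1 * k)
    = quad' * Dg k.+1 *+ n + Dg k *+ (2 * n * k.+1).
Proof.
elim: k => [|k IHk].
  have : quad * Dg 1 = quad' * Dg 0 *+ n.
    rewrite derivn1 derivn0 /qpow; case: (n) => [|j].
      by rewrite expr0 -polyC1 derivC mulr0 mulr0n.
    by rewrite deriv_exp dq0 /= mulrnAr mulrCA -exprS.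
  move/(congr1 (@deriv R)). rewrite derivMn (derivM quad) (derivM quad') dq0 dq1 !deriv_Dg => E.
  by apply: (eq_of_sub_eq E); ring.
move/(congr1 (@deriv R)): IHk.
rewrite !derivD !derivMn (derivM quad) !(derivM quad') dq0 dq1 !deriv_Dg.
exact: qpow_ode_step.
Qed.

Lemma derivn_Xg k : ('X * g)^`(k.+1) = 'X * Dg k.+1 + Dg k *+ k.+1.
Proof.
elim: k => [|k IHk]; first by rewrite derivn1 derivM derivX mul1r addrC.
rewrite derivnS IHk derivD derivMn derivM derivX !deriv_Dg mul1r.
by rewrite addrAC addrC -mulrS.
Qed.

Lemma derivn_X1g k :
  (('X - 1%:P) * g)^`(k.+1) = ('X - 1%:P) * Dg k.+1 + Dg k *+ k.+1.
Proof.
elim: k => [|k IHk]; first by rewrite derivn1 derivM derivXsubC mul1r addrC.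
rewrite derivnS IHk derivD derivMn derivM derivXsubC !deriv_Dg mul1r.
by rewrite addrAC addrC -mulrS.
Qed.

(** For [a0 = g^`(k)], [a1 = a0'], [a2 = a0''] the hypothesis is [qpow_ode]; the
    last two terms are then multiples of the derivatives of [q * a0 * a1] and
    [t * a0 * a0], so that they do not contribute to the integral over [0, 1] when [a0] vanishes at the
    ends. *)
Fact bilinear_identity (A : comNzRingType) (k : nat) (x a2 a1 a0 : A) :
  let q := x * (x - 1) in let t := x + (x - 1) in
  q * a2 + t * a1 *+ k.+1 + a0 *+ (k.+1 * k)
    = t * a1 *+ n + a0 *+ (2 * n * k.+1) ->
  ((x * a1 + a0 *+ k.+1) * ((x - 1) * a1 + a0 *+ k.+1)) *+ 2
  = (a0 * a0) * ((n%:R + 1 - k.+1%:R) * (1 - 2 * k.+1%:R)) *+ 2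
    + (t * a0 * a1 + q * a1 * a1 + q * a0 * a2) *+ 2
    + (2 * (a0 * a0) + t * (a0 * a1 + a0 * a1)) * (2 * k.+1%:R - 1 - n%:R).
Proof.
move=> q t /esym /(congr1 (fun z => a0 *+ 2 * z)) E.
by apply: (eq_of_sub_eq E); rewrite /q /t; ring.
Qed.

Let g_monic : g \is monic.
Proof. by rewrite monic_exp// monicMl ?monicX// monicXsubC. Qed.

Let size_g : size g = (n.*2).+1.
Proof.
rewrite /qpow /quad exprMn size_monicM ?monicXn ?expf_neq0 ?polyXsubC_eq0//.
rewrite size_polyXn size_exp_XsubC; lia.
Qed.

Let Dg_neq0 k : (k <= n)%N -> Dg k != 0.
Proof.
move=> kn; apply/eqP => /(congr1 (fun p => p`_(n.*2 - k))).
rewrite coef_derivn coef0 subnKC; last by lia.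
have := monicP g_monic; rewrite /lead_coef size_g /= => -> /eqP.
rewrite pnatr_eq0 -leqn0 leqNgt ffact_gt0; lia.
Qed.

Let Dg_root k (c : R) : (c == 0) || (c == 1) -> (k < n)%N -> (Dg k).[c] = 0.
Proof.
move=> c01 kn; apply: derivn_root_lt kn; rewrite /qpow /quad exprMn.
case/orP: c01 => /eqP ->; last exact: dvdp_mull.
by rewrite polyC0 subr0 dvdp_mulr.
Qed.

Let hornerE1 (c : R) : (quad).[c] = c * (c - 1).
Proof. by rewrite /quad hornerM hornerX hornerXsubC. Qed.

(** For [l = 0] the integrand is negative inside [0, 1]. For [l = k + 1],
    [bilinear_identity] makes the integral equal to [(n - k) * (- 1 - 2 * k)]
    times that of the square of [g^`(k)]. *)
Lemma pint_Xg_X1g l : (l <= n)%N ->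
  pint (('X * g)^`(l) * (('X - 1%:P) * g)^`(l)) != 0.
Proof.
case: l => [_|k kn].
  suff : 0 < pint (- 1 *: (('X * g)^`(0) * (('X - 1%:P) * g)^`(0))).
    by rewrite pintZ; apply: contraTneq => ->; rewrite mulr0 ltxx.
  have -> : ('X * g)^`(0) * (('X - 1%:P) * g)^`(0) = quad * (g * g).
    by rewrite !derivn0 /quad mulrACA.
  apply: pint_gt0 => [x /andP[x0 x1]|].
    rewrite hornerZ hornerM (hornerM g) hornerE1 mulN1r -mulNr.
    apply: mulr_ge0; last by rewrite -expr2 sqr_ge0.
    by rewrite -mulrN opprB mulr_ge0// subr_ge0.
  rewrite scaler_eq0 oppr_eq0 oner_eq0 /=.
  have quad_neq0 : quad != 0 :> {poly R}.
    by rewrite /quad mulf_neq0 ?polyX_eq0 ?polyXsubC_eq0.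
  have g0 := monic_neq0 g_monic.
  by apply: mulf_neq0 => //; apply: mulf_neq0.
have [Q0 Q1] : (Dg k).[0] = 0 /\ (Dg k).[1] = 0.
  by split; apply: Dg_root; rewrite ?eqxx ?orbT.
pose c : R := (n%:R + 1 - k.+1%:R) * (1 - 2 * k.+1%:R).
pose a : R := 2 * k.+1%:R - 1 - n%:R.
have := qpow_ode k; rewrite /quad /quad' => /(@bilinear_identity _ _ 'X).
rewrite -derivn_Xg -polyC1 -derivn_X1g -/quad -/quad' polyC1.
have -> : Dg k * Dg k * ((n%:R + 1 - k.+1%:R) * (1 - 2 * k.+1%:R)) *+ 2
    = (c *+ 2) *: (Dg k * Dg k).
  rewrite -mul_polyC polyCMn [RHS]mulrnAl [c%:P * _]mulrC /c.
  by rewrite !(polyCM, polyCB, polyCD, polyC1, polyC_natr).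
have -> : (quad' * Dg k * Dg k.+1 + quad * Dg k.+1 * Dg k.+1
    + quad * Dg k * Dg k.+2) = (quad * Dg k * Dg k.+1)^`().
  by rewrite derivM (derivM quad) dq0 !deriv_Dg (mulrDl (quad' * _)).
have -> : (2 * (Dg k * Dg k) + quad' * (Dg k * Dg k.+1 + Dg k * Dg k.+1))
    * (2 * k.+1%:R - 1 - n%:R) = a *: (quad' * (Dg k * Dg k))^`().
  rewrite -mul_polyC mulrC /a !(polyCM, polyCB, polyCD, polyC1, polyC_natr).
  congr (_ * _); rewrite (derivM quad') dq1 derivM !deriv_Dg.
  by rewrite (mulrC (Dg k.+1)).
move/(congr1 pint); rewrite !(pintD, pintMn, pintZ).
rewrite !pint_deriv !hornerM Q0 Q1 !(mulr0, mul0r, subrr, addr0, mul0rn).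
move=> E; apply/eqP => E0; move: E; rewrite E0 addr0 => /esym/eqP.
rewrite mulf_eq0 mulrn_eq0 /= /c mulf_eq0.
have QQ : 0 < pint (Dg k * Dg k).
  apply: pint_gt0 => [x _|]; first by rewrite hornerM -expr2 sqr_ge0.
  by rewrite mulf_neq0// Dg_neq0// ltnW.
rewrite (gt_eqF QQ) orbF.
have : (k.+1%:R : R) <= n%:R by rewrite ler_nat.
have : 1 <= (k.+1%:R : R) by rewrite ler1n.
by move=> ? ? /orP[|] /eqP; lra.
Qed.

Lemma derivn_comp1X p l :
  (p \Po (1%:P - 'X))^`(l) = (- 1) ^+ l *: (p^`(l) \Po (1%:P - 'X)).
Proof.
elim: l => [|l IHl]; first by rewrite !derivn0 scale1r.
rewrite !derivnS IHl derivZ deriv_comp derivB derivC derivX sub0r mulrN1.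
by rewrite scalerN exprS mulN1r scaleNr.
Qed.

(** The entries of [fhilb (2r+2)] are beta integrals, so the quadratic form is
    the integral over [0, 1] of [F(x) * F(1 - x)], where [F] is the derivative of
    order [n - r] of the polynomial of [rho]: this is Duhamel's formula for the
    variation of the curve. The symmetry of [qpow] then reduces the claim to
    [pint_Xg_X1g]. *)
Lemma rho_form_neq0 r : (r <= n)%N ->
  (rho n *m fhilb n r.*2.+2 *m (rho n)^T) 0 0 != 0 :> R.
Proof.
move=> rn; pose l := (n - r)%N.
pose F := (rowpoly (rho n))^`(l) : {poly R}.
have [c c0 rhoE] := @rowpoly_rho R n.
have -> : (rho n *m fhilb n r.*2.+2 *m (rho n)^T) 0 0 = pint (F * (F \Po (1%:P - 'X))).
  rewrite /F derivn_rowpoly; last by rewrite leq_subr.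
  rewrite -[_ \Po _]/(comp_poly _ _) linear_sum /= mulr_sumr pint_sum mxE.
  apply: eq_bigr => j _; rewrite mulr_suml pint_sum [(rho n)^T _ _]mxE.
  rewrite mxE mulr_suml; apply: eq_bigr => i _.
  rewrite comp_polyZ /dpow !comp_polyZ comp_Xn_poly -!scalerAl -!scalerAr !pintZ.
  rewrite polyC1 pint_beta [fhilb _ _ _ _]mxE -[_ *: _]/(_ * _).
  rewrite (_ : _ + _ - _ - _ = (n.*2.+1 - i - l + (n.*2.+1 - j - l)).+1)%N; last first.
    by have := ltn_ord i; have := ltn_ord j; rewrite /l; lia.
  have := fact_gt0 (n.*2.+1 - i - l); rewrite -(ltr0n R) => /lt0r_neq0 ?.
  have := fact_gt0 (n.*2.+1 - j - l); rewrite -(ltr0n R) => /lt0r_neq0 ?.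
  by field; rewrite pnatr_eq0 -lt0n fact_gt0; apply/and3P.
have /esym := derivn_comp1X (rowpoly (rho n)) l.
move/(congr1 (fun p => (-1) ^+ l *: p)); rewrite scalerA -expr2 sqrr_sign scale1r.
rewrite -/F => ->; rewrite /F rhoE comp_polyZ comp_polyM comp_polyX.
have -> : g \Po (1%:P - 'X) = g.
  rewrite /qpow -[_ \Po _]/(comp_poly _ _) rmorphXn /=; congr (_ ^+ _).
  by rewrite /quad comp_polyM comp_polyB comp_polyX comp_polyC; ring.
rewrite (_ : 1%:P - 'X = - 1 *: ('X - 1%:P)); last by rewrite scaleN1r opprB.
rewrite -[in X in _ * X]scalerAl !derivnZ -!scalerAl -!scalerAr !pintZ.
by rewrite !mulf_neq0 ?signr_eq0 ?oppr_eq0 ?oner_eq0// pint_Xg_X1g// leq_subr.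
Qed.

End Nonvanishing.
(** * The universal expansion of the trace *)

Section Graded.
Context {R : realType}.
Implicit Types (X Y : (nat -> nat -> R) -> R) (P Q : (nat -> nat -> R) -> {poly R}).

Definition homf (w : int) X : Prop :=
  exists2 e, homog e w & forall y, deval e y = X y.

(** Series in the time increment [h] that are invariant under a simultaneous
    rescaling of time: the coefficient of [h ^+ s] has weight [s]. *)
Definition ghom P : Prop := forall s : nat, homf s (fun y => (P y)`_s).

Definition ghommx a b (M : (nat -> nat -> R) -> 'M[{poly R}]_(a, b)) : Prop :=
  forall i j, ghom (fun y => M y i j).

Lemma homf0 w : homf w (fun=> 0).
Proof. by exists (DCst 0) => //; exact: homog0. Qed.

Lemma homfD w X Y : homf w X -> homf w Y -> homf w (fun y => X y + Y y).
Proof.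
move=> [a ha aX] [b hb bY]; exists (DAdd a b); first exact: homogD.
by move=> y /=; rewrite aX bY.
Qed.

Lemma homfM v w X Y : homf v X -> homf w Y -> homf (v + w) (fun y => X y * Y y).
Proof.
move=> [a ha aX] [b hb bY]; exists (DMul a b); first exact: homogM.
by move=> y /=; rewrite aX bY.
Qed.

Lemma homfZ c w X : homf w X -> homf w (fun y => c * X y).
Proof.
move=> hX; rewrite -[w]add0r; apply: homfM hX.
by exists (DCst c) => //; exact: homogC.
Qed.

Lemma homf_sum w (I : Type) (r : seq I) (F : I -> (nat -> nat -> R) -> R) :
  (forall i, homf w (F i)) -> homf w (fun y => \sum_(i <- r) F i y).
Proof.
move=> hF; elim: r => [|i r IHr].
  by under eq_fun do rewrite big_nil; exact: homf0.
by under eq_fun do rewrite big_cons; exact: homfD.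
Qed.

Lemma ghomC c : ghom (fun=> c%:P).
Proof.
move=> [|s]; last by under eq_fun do rewrite coefC; exact: homf0.
under eq_fun do rewrite coefC eqxx.
by exists (DCst c) => //; exact: homogC.
Qed.

Lemma ghomD P Q : ghom P -> ghom Q -> ghom (fun y => P y + Q y).
Proof. by move=> hP hQ s; under eq_fun do rewrite coefD; exact: homfD. Qed.

Lemma ghomN P : ghom P -> ghom (fun y => - P y).
Proof.
by move=> hP s; under eq_fun do rewrite coefN -mulN1r; exact: homfZ.
Qed.

Lemma ghomM P Q : ghom P -> ghom Q -> ghom (fun y => P y * Q y).
Proof.
move=> hP hQ s; under eq_fun do rewrite coefM.
apply: homf_sum => i; rewrite (_ : (s : int) = (i : nat)%:Z + (s - i)%N%:Z).
  exact: homfM.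
by have := ltn_ord i; lia.
Qed.

Lemma ghom_sum (I : Type) (r : seq I) (F : I -> (nat -> nat -> R) -> {poly R}) :
  (forall i, ghom (F i)) -> ghom (fun y => \sum_(i <- r) F i y).
Proof.
by move=> hF s; under eq_fun do rewrite coef_sum; apply: homf_sum => i; exact: hF.
Qed.

Lemma ghommxM a b c (M : (nat -> nat -> R) -> 'M[{poly R}]_(a, b))
    (N : (nat -> nat -> R) -> 'M[{poly R}]_(b, c)) :
  ghommx M -> ghommx N -> ghommx (fun y => M y *m N y).
Proof.
move=> hM hN i j; under eq_fun do rewrite mxE.
by apply: ghom_sum => k; exact: ghomM.
Qed.

Lemma ghommxC a b (M : 'M[R]_(a, b)) : ghommx (fun=> map_mx polyC M).
Proof. by move=> i j; under eq_fun do rewrite mxE; exact: ghomC. Qed.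

Lemma ghommxB a b (M N : (nat -> nat -> R) -> 'M[{poly R}]_(a, b)) :
  ghommx M -> ghommx N -> ghommx (fun y => M y - N y).
Proof.
move=> hM hN i j; under eq_fun do rewrite !mxE.
by apply: ghomD => //; exact: ghomN.
Qed.

Lemma ghommx_sum a b (I : Type) (r : seq I) 
    (F : I -> (nat -> nat -> R) -> 'M[{poly R}]_(a, b)) :
  (forall i, ghommx (F i)) -> ghommx (fun y => \sum_(i <- r) F i y).
Proof.
move=> hF i j; under eq_fun do rewrite summxE.
by apply: ghom_sum => k; exact: hF.
Qed.

Lemma ghommxX a (M : (nat -> nat -> R) -> 'M[{poly R}]_a.+1) k :
  ghommx M -> ghommx (fun y => M y ^+ k).
Proof.
move=> hM; elim: k => [|k IHk].
  by have := ghommxC (1%:M : 'M[R]_a.+1); rewrite map_mx1.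
by under eq_fun do rewrite exprS; exact: ghommxM.
Qed.

Lemma ghom_eq0 P s r : ghom P -> (0 < s < r.*2.+2)%N -> (P (djet r))`_s = 0.
Proof.
by move=> /(_ s)[e he eP] /andP[s0 sr]; rewrite -eP (homog_djet0 he)// ltz_nat.
Qed.

End Graded.

Section Chain.
Context {R : realType}.
Variables (n : nat) (eps : bool).

(** The signs that turn the frame into the chain below. *)
Definition kap p : R := (-1) ^+ (eps + (p - n.+1)).

(** The structure equations of the moving frame put it in a chain
    [G_0, ..., G_(2n+1)], namely [E_0, ..., E_n, +-F_n, ..., +-F_0], in which
    [G_p' = G_(p+1)], plus the multiple [kap p * lambda_(p-n-1)] of
    [G_(2n+1-p)] if [p > n]. Here [cf i k p] is the coefficient of [G_p] in the
    [k]-th derivative of [G_i]. *)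
Fixpoint cf (i k p : nat) : dexp R :=
  match k with
  | 0 => DCst (p == i)%:R
  | k'.+1 =>
    DAdd (dtotal (cf i k' p))
      (DAdd (if p is p'.+1 then cf i k' p' else DCst 0)
        (if (p <= n)%N then
           DMul (DMul (DCst (kap (n.*2.+1 - p))) (DVar (n - p) 0))
                (cf i k' (n.*2.+1 - p))
         else DCst 0))
  end.

Lemma homog_cf i k p : homog (cf i k p) ((k + i)%:Z - p%:Z).
Proof.
elim: k p => [|k IHk] p /=.
  by case: eqP => [->|_]; [rewrite add0n subrr; exact: homogC|exact: homog0].
apply: homogD.
  by have := homog_total (IHk p); rewrite (_ : _ + 1 = (k.+1 + i)%:Z - p%:Z)//; lia.
apply: homogD.
  case: p => [|p]; first exact: homog0.
  by have := IHk p; rewrite (_ : _ - _ = (k.+1 + i)%:Z - p.+1%:Z)//; lia.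
case: leqP => pn; last exact: homog0.
rewrite (_ : _ - _ = 0 + ((n - p).*2.+2 + 0)%N%:Z
   + ((k + i)%:Z - (n.*2.+1 - p)%N%:Z)); last by lia.
by apply: homogM => //; apply: homogM; [exact: homogC|exact: homogV].
Qed.

Lemma dvars_lt_cf i k p : dvars_lt n.+1 (cf i k p).
Proof.
elim: k p => [//|k IHk] p /=; rewrite (dvars_lt_total 1)//= .
apply/andP; split; first by case: p.
by case: leqP => //= pn; rewrite IHk andbT ltnS leq_subr.
Qed.

Lemma deval_cf_diag i k y : deval (cf i k (k + i)) y = 1.
Proof.
have -> : deval (cf i k (k + i)) y = deval (cf i k (k + i)) (fun _ _ => 0).
  by apply: homog_wt0 (homog_cf _ _ _) _; rewrite subrr.
elim: k => [|k IHk] /=; first by rewrite add0n eqxx.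
rewrite IHk deval_total_cst// add0r; case: ifP => /= _.
  by rewrite mulr0 mul0r addr0.
by rewrite addr0.
Qed.

(** With a single constant [lambda_r], the chain has, besides its straight
    edges, one edge going back from [G_(n+1+r)] to [G_(n-r)]: the coefficient
    below counts the paths that use this edge once. *)
Lemma deval_cf_djet r i k p : (r <= n)%N -> (i <= n)%N ->
  (k + i = p + r.*2.+2)%N ->
  deval (cf i k p) (djet r) = if (n - r <= p)%N then kap (n.+1 + r) else 0.
Proof.
move=> rn iN; elim: k p => [|k IHk] p kip /=.
  case: eqP; first by lia.
  by case: leqP => //; lia.
rewrite deval_total_cst ?add0r; last by move=> j d; rewrite /djet andbF.
have [pr|pr|pr] := ltngtP p (n - r)%N.
- have pn : (p <= n)%N by lia.
  have npr : (n - p == r)%N = false by lia.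
  have nrp : (n - r <= p)%N = false by lia.
  rewrite pn /= [djet r _ _]/djet npr /= mulr0 mul0r addr0.
  case: p kip {pr pn npr} nrp => [//|p] kip nrp.
  have kp : (k + i = p + r.*2.+2)%N by lia.
  have nrp' : (n - r <= p)%N = false by lia.
  by rewrite IHk// nrp'.
- rewrite (_ : deval _ _ = kap (n.+1 + r)).
    case: leqP => pn /=; last by rewrite addr0.
    have npr : (n - p == r)%N = false by lia.
    by rewrite [djet r _ _]/djet npr /= mulr0 mul0r addr0.
  case: p pr kip => [//|p] pr kip.
  have kp : (k + i = p + r.*2.+2)%N by lia.
  have nrp : (n - r <= p)%N by lia.
  by rewrite IHk// nrp.
- have pn : (p <= n)%N by lia.
  have npr : (n - p == r)%N by lia.
  rewrite pn /= [djet r _ _]/djet npr /= mulr1.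
  have -> : (n.*2.+1 - p)%N = (k + i)%N by lia.
  rewrite deval_cf_diag mulr1 (_ : deval _ _ = 0).
    by rewrite add0r; congr kap; lia.
  case: p pr kip {pn npr} => [//|p] pr kip.
  have kp : (k + i = p + r.*2.+2)%N by lia.
  have nrp : (n - r <= p)%N = false by lia.
  by rewrite IHk// nrp.
Qed.

End Chain.

Section Expansion.
Context {R : realType}.
Variables (n : nat) (eps : bool) (K : nat).
Hypothesis K0 : (0 < K)%N.
Implicit Types y : nat -> nat -> R.

(** The expansion of [sigma (E_i(t + h)) (E_j(t))], up to the sign
    [kap (2n+1-j)], divided by its leading power [h ^+ (2n+1-i-j)]. *)
Definition gram_poly y : 'M[{poly R}]_n.+1 := \matrix_(i, j)
  \poly_(s < K) (deval (cf n eps i (n.*2.+1 - i - j + s) (n.*2.+1 - j)) y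
                 / (n.*2.+1 - i - j + s)`!%:R).

Definition gram0 : 'M[{poly R}]_n.+1 := map_mx polyC (fhilb n 0).
Definition gram0V : 'M[{poly R}]_n.+1 := map_mx polyC (invmx (fhilb n 0)).

Lemma gram0K : gram0 * gram0V = 1.
Proof.
rewrite -[_ * _]/(_ *m _) /gram0 /gram0V -map_mxM mulmxV ?fhilb_unit//.
by rewrite map_mx1.
Qed.

Lemma gram0VK : gram0V * gram0 = 1.
Proof.
rewrite -[_ * _]/(_ *m _) /gram0 /gram0V -map_mxM mulVmx ?fhilb_unit//.
by rewrite map_mx1.
Qed.

Lemma ghommx_gram : ghommx gram_poly.
Proof.
move=> i j s; under eq_fun do rewrite mxE coef_poly.
case: (s < K)%N; last exact: homf0.
have ? := ltn_ord i; have ? := ltn_ord j.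
exists (DMul (DCst ((n.*2.+1 - i - j + s)`!%:R)^-1)
  (cf n eps i (n.*2.+1 - i - j + s) (n.*2.+1 - j))) => [|y /=]; last by rewrite mulrC.
rewrite (_ : (s : int) = 0 + ((n.*2.+1 - i - j + s + i)%N%:Z - (n.*2.+1 - j)%N%:Z)).
  by apply: homogM; [exact: homogC|exact: homog_cf].
by lia.
Qed.

Lemma gram_coef0 y i j : (gram_poly y i j)`_0 = fhilb n 0 i j.
Proof.
rewrite mxE coef_poly K0 addn0 mxE addn0.
have -> : (n.*2.+1 - j = n.*2.+1 - i - j + i)%N.
  by have := ltn_ord i; have := ltn_ord j; lia.
by rewrite deval_cf_diag mul1r.
Qed.

Lemma det_gram_coef0 y : (\det (gram_poly y))`_0 = \det (fhilb n 0).
Proof.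
have -> : (\det (gram_poly y))`_0 = \det (map_mx (horner_eval (0 : R)) (gram_poly y)).
  by rewrite det_map_mx /= /horner_eval horner_coef0.
congr (\det _); apply/matrixP => i j.
by rewrite mxE /horner_eval horner_coef0 gram_coef0.
Qed.

Lemma gram_coef_djet r i j : (r <= n)%N -> (r.*2.+2 < K)%N ->
  (gram_poly (djet r) i j)`_(r.*2.+2) = kap n eps (n.+1 + r) * fhilb n r.*2.+2 i j.
Proof.
move=> rn rK; rewrite mxE coef_poly rK mxE.
have ? := ltn_ord i; have ? := ltn_ord j.
rewrite deval_cf_djet//; last by lia.
rewrite (_ : (n - r <= n.*2.+1 - j)%N); last by lia.
by congr (_ / _`!%:R); lia.
Qed.

Definition gram_defect y : 'M[{poly R}]_n.+1 := 1 - gram_poly y * gram0V.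

(** A Neumann series: the last row of the inverse of [gram_poly y], as a
    truncated power series. *)
Definition nu y : 'rV[{poly R}]_n.+1 :=
  delta_mx 0 ord_max *m gram0V *m \sum_(k < K) gram_defect y ^+ k.

Lemma ghommx_nu : ghommx nu.
Proof.
apply: ghommxM.
  have -> : delta_mx (0 : 'I_1) ord_max *m gram0V = map_mx polyC (rho n).
    by rewrite /rho map_mxM map_delta_mx.
  exact: ghommxC.
apply: ghommx_sum => k; apply: ghommxX; apply: ghommxB.
  by have := @ghommxC R _ _ (1%:M : 'M[R]_n.+1); rewrite map_mx1.
by apply: ghommxM; [exact: ghommx_gram|exact: ghommxC].
Qed.

Lemma gram_defectE y : exists U, gram_defect y = 'X *: U.
Proof.
exists (map_mx (fun p : {poly R} => p %/ 'X) (gram_defect y)).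
apply/matrixP => i j; rewrite [RHS]mxE [X in _ = _ * X]mxE mulrC divpK//.
rewrite -['X]subr0 -polyC0 dvdp_XsubCl /root horner_coef0.
have E0 : gram_poly y * gram0V = 1 + (gram_poly y - gram0) * gram0V.
  by rewrite mulrBl gram0K addrC subrK.
have -> : gram_defect y i j = - \sum_k (gram_poly y i k - gram0 i k) * gram0V k j.
  rewrite /gram_defect E0 opprD addrA subrr add0r mxE; congr (- _).
  by rewrite -[_ * _]/(_ *m _) mxE; apply: eq_bigr => k _; rewrite !mxE.
rewrite coefN coef_sum big1 ?oppr0// => k _.
rewrite coefM big_ord1 coefB gram_coef0 /gram0.
by rewrite [map_mx _ _ _ _]mxE coefC subrr mul0r.
Qed.

Lemma nuK y : exists T, nu y *m gram_poly y = delta_mx 0 ord_max + 'X^K *: T.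
Proof.
have [U dU] := gram_defectE y.
exists (- (delta_mx 0 ord_max *m gram0V *m (U ^+ K * gram0))).
have -> : gram_poly y = (1 - gram_defect y) * gram0.
  by rewrite /gram_defect opprB addrC subrK -mulrA gram0VK mulr1.
have sumE : (\sum_(k < K) gram_defect y ^+ k) * (1 - gram_defect y)
    = 1 - gram_defect y ^+ K.
  rewrite -opprB mulrN -[RHS]opprB subrX1; congr (- _).
  apply: commrB; last exact: commr1.
  by apply/commr_sym/commr_sum => k _; exact: commrX.
rewrite /nu -mulmxA (mulmxA (\sum_(k < K) _)) -[(\sum_(k < K) _) *m _]/(_ * _) sumE.
rewrite -[_ *m gram0]/(_ * gram0) mulrBl mul1r mulmxBr.
rewrite -[X in X - _]mulmxA -[gram0V *m gram0]/(gram0V * gram0) gram0VK mulmx1.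
by rewrite dU exprZn -scalerAl -!scalemxAr scalerN.
Qed.

Lemma nu_coef0 y i : (nu y 0 i)`_0 = rho n 0 i.
Proof.
pose v : 'rV[R]_n.+1 := \row_i (nu y 0 i)`_0.
suff -> : rho n = v by rewrite [RHS]mxE.
rewrite /rho -[RHS](mulmxK (@fhilb_unit R n)); congr (_ *m _).
have [T dT] := nuK y; apply/rowP => j.
move/matrixP/(_ 0 j)/(congr1 (fun p : {poly R} => p`_0)): dT.
rewrite mxE coef_sum [in RHS]mxE coefD [('X^K *: T) _ _]mxE coefXnM K0 addr0.
rewrite -(map_delta_mx polyC) [map_mx _ _ _ _]mxE coefC eqxx => <-.
rewrite mxE; apply: eq_bigr => k _.
by rewrite coefM big_ord1 gram_coef0 [v _ _]mxE.
Qed.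

(** To first order in [lambda_r], the matrix identity [nu * N = e_n] relates the
    variation of [nu] to that of [N]. *)
Lemma nu_coef_djet r : (r <= n)%N -> (r.*2.+2 < K)%N ->
  (nu (djet r) 0 ord_max)`_(r.*2.+2)
  = - kap n eps (n.+1 + r) * (rho n *m fhilb n r.*2.+2 *m (rho n)^T) 0 0.
Proof.
move=> rn rK; set w := r.*2.+2; set c := kap _ _ _.
pose v : 'rV[R]_n.+1 := \row_i (nu (djet r) 0 i)`_w.
have vE : v *m fhilb n 0 = - c *: (rho n *m fhilb n w).
  have [T dT] := nuK (djet r); apply/rowP => j.
  move/matrixP/(_ 0 j)/(congr1 (fun p : {poly R} => p`_w)): dT.
  rewrite mxE coef_sum [in RHS]mxE coefD [('X^K *: T) _ _]mxE coefXnM rK addr0.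
  rewrite -(map_delta_mx polyC) [map_mx _ _ _ _]mxE coefC /=.
  have -> : \sum_k (nu (djet r) 0 k * gram_poly (djet r) k j)`_w =
      (v *m fhilb n 0) 0 j + c * (rho n *m fhilb n w) 0 j.
    rewrite !mxE mulr_sumr -big_split /=; apply: eq_bigr => k _.
    rewrite coefM big_ord_recr big_ord_recl /= subn0 subnn nu_coef0 gram_coef0.
    rewrite gram_coef_djet// big1 ?addr0; last first.
      move=> i _; rewrite (ghom_eq0 (ghommx_nu _ _)) ?mul0r//= /bump /= add1n.
      by rewrite ltnS ltn_ord.
    by rewrite addrC [v _ _]mxE mulrCA.
  by rewrite !mxE => /eqP; rewrite addr_eq0 => /eqP ->; rewrite mulNr.
have AT : (fhilb n 0)^T = fhilb n 0 :> 'M[R]__.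
  by apply/matrixP => i j; rewrite !mxE subnAC.
have rhoT : (rho n)^T = invmx (fhilb n 0) *m delta_mx ord_max 0 :> 'cV[R]__.
  by rewrite /rho trmx_mul trmx_inv AT trmx_delta.
have -> : (nu (djet r) 0 ord_max)`_w = (v *m delta_mx ord_max 0) 0 (0 : 'I_1).
  rewrite [RHS]mxE (bigD1 ord_max)//= [v _ _]mxE [delta_mx _ _ _ _]mxE !eqxx mulr1 big1 ?addr0// => k km.
  by rewrite [delta_mx _ _ _ _]mxE (negbTE km) mulr0.
rewrite rhoT mulmxA -(mulmxK (@fhilb_unit R n) v) vE -!scalemxAl.
by rewrite mxE.
Qed.

Lemma nu_sq_coef_djet r : (r <= n)%N -> (r.*2.+2 < K)%N ->
  ((nu (djet r) 0 ord_max) ^+ 2)`_(r.*2.+2) != 0.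
Proof.
move=> rn rK; rewrite expr2 coefM big_ord_recr big_ord_recl /= subn0 subnn.
rewrite big1 ?addr0; last first.
  move=> i _; rewrite (ghom_eq0 (ghommx_nu _ _)) ?mul0r//= /bump /= add1n.
  by rewrite ltnS ltn_ord.
rewrite nu_coef0 nu_coef_djet// [X in _ + X]mulrC -mulr2n -mulr_natl.
apply: mulf_neq0; first by rewrite pnatr_eq0.
apply: mulf_neq0; first exact: rho_last_neq0.
by apply: mulf_neq0; rewrite ?rho_form_neq0// oppr_eq0 signr_eq0.
Qed.

(** The weight leaves room for [lambda_r] only linearly ([homog_top]), and
    [nu_sq_coef_djet] is its coefficient. *)
Lemma nu_sq_expansion r : (r <= n)%N -> (r.*2.+2 < K)%N ->
  exists e c, [/\ c != 0, dvars_lt r e, deval e (fun _ _ => 0) = 0 &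
    forall y, ((nu y 0 ord_max) ^+ 2)`_(r.*2.+2) = deval e y + c * y r 0].
Proof.
move=> rn rK.
have [e he eE] : homf r.*2.+2 (fun y => ((nu y 0 ord_max) ^+ 2)`_(r.*2.+2)).
  by under eq_fun do rewrite expr2; apply: ghomM; exact: ghommx_nu.
exists (dtrunc r e), (deval e (djet r)); split.
- by rewrite eE nu_sq_coef_djet.
- exact: dvars_lt_trunc.
- by apply: homog_deval0 (homog_trunc r he) _.
- by move=> y; rewrite -eE (homog_top (r := r) y he)// eqxx mul1r.
Qed.

(** Cramer's rule, modulo ['X^K]. *)
Lemma nu_sq_unique y (u : {poly R}) :
  ('X^K %| u * (\det (gram_poly y)) ^+ 2
           - (\adj (gram_poly y) ord_max ord_max) ^+ 2)%R ->
  forall s, (s < K)%N -> u`_s = ((nu y 0 ord_max) ^+ 2)`_s.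
Proof.
set N := gram_poly y; set d := \det N; set a := \adj N _ _ => dvdu s sK.
have [T dT] := nuK y.
have nud : nu y 0 ord_max * d = a + 'X^K * (T *m \adj N) 0 ord_max.
  move/(congr1 (fun M => M *m \adj N)): dT.
  rewrite -mulmxA mul_mx_adj mulmxDl -scalemxAl mul_mx_scalar.
  move/matrixP/(_ 0 ord_max); rewrite mxE mulrC => ->.
  rewrite mxE; congr (_ + _); last by rewrite [LHS]mxE.
  by rewrite -rowE mxE.
set t := (T *m _) 0 _ in nud.
have : ('X^K %| (nu y 0 ord_max ^+ 2 - u) * d ^+ 2)%R.
  rewrite mulrBl -exprMn nud.
  rewrite (_ : _ - _ = 'X^K * (2 * a * t + 'X^K * t ^+ 2) - (u * d ^+ 2 - a ^+ 2)).
    by rewrite dvdp_sub// dvdp_mulr.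
  ring.
rewrite Gauss_dvdpl; last first.
  apply/coprimep_expl/coprimep_expr; rewrite coprimep_sym -['X]subr0 -polyC0.
  rewrite coprimep_XsubC /root horner_coef0.
  rewrite det_gram_coef0.
  by have := @fhilb_unit R n; rewrite unitmxE unitfE.
case/dvdpP => q /(congr1 (fun p : {poly R} => p`_s)).
rewrite coefMXn sK coefB => /eqP; by rewrite subr_eq0 => /eqP ->.
Qed.

End Expansion.
(** * Taylor expansions *)

Section Expansions.
Context {R : realType}.
Implicit Types (f g r : R -> R) (p q : {poly R}) (K : nat).

Definition bounded_dnbhs f : Prop :=
  exists C, \forall h \near (0 : R)^', `|f h| <= C.

(** [f h = p.[h] + O(h ^+ K)] as [h] tends to [0]; the value of [f] at [0] does
    not matter, so that this applies to quotients by powers of [h]. *)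
Definition expands K f p : Prop :=
  exists2 r, bounded_dnbhs r &
    \forall h \near (0 : R)^', f h = p.[h] + h ^+ K * r h.

Lemma bounded_dnbhsD f g :
  bounded_dnbhs f -> bounded_dnbhs g -> bounded_dnbhs (f \+ g).
Proof.
move=> [C fC] [D gD]; exists (C + D); near=> h.
by rewrite /= (le_trans (ler_normD _ _))// lerD//; near: h.
Unshelve. all: by end_near. Qed.

Lemma bounded_dnbhsM f g :
  bounded_dnbhs f -> bounded_dnbhs g -> bounded_dnbhs (f \* g).
Proof.
move=> [C fC] [D gD]; exists (C * D); near=> h.
by rewrite /= normrM ler_pM//; near: h.
Unshelve. all: by end_near. Qed.

Lemma bounded_dnbhs_continuous f : {for 0, continuous f} -> bounded_dnbhs f.
Proof.
move=> f0; exists (`|f 0| + 1).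
have : \forall h \near (0 : R)^', `|f 0 - f h| < 1.
  apply: nbhs_dnbhs.
  by have /cvgrPdist_lt := f0; apply.
apply: filterS => h fh.
rewrite (_ : f h = f 0 - (f 0 - f h)); last by rewrite subKr.
by rewrite (le_trans (ler_normB _ _))// lerD2l ltW.
Qed.

Lemma bounded_dnbhs_poly p : bounded_dnbhs (horner p).
Proof. by apply: bounded_dnbhs_continuous; exact: continuous_horner. Qed.

Lemma bounded_dnbhsX k : bounded_dnbhs (fun h => h ^+ k).
Proof.
have -> : (fun h : R => h ^+ k) = horner 'X^k by apply/funext => h; rewrite hornerXn.
exact: bounded_dnbhs_poly.
Qed.

Lemma near_expands K f g p :
  (\forall h \near (0 : R)^', f h = g h) -> expands K f p -> expands K g p.
Proof.
move=> fg [r rb fp]; exists r => //; near=> h.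
have <- : f h = g h by near: h.
by near: h.
Unshelve. all: by end_near. Qed.

Lemma expands_poly K p : expands K (horner p) p.
Proof.
exists (fun=> 0); first by exists 0; near=> h; rewrite normr0.
by near=> h; rewrite mulr0 addr0.
Unshelve. all: by end_near. Qed.

Lemma expandsC K c : expands K (fun=> c) c%:P.
Proof.
have -> : (fun=> c) = horner c%:P by apply/funext => h; rewrite hornerC.
exact: expands_poly.
Qed.

Lemma expands_sign K k : expands K (fun=> (-1) ^+ k) ((-1) ^+ k).
Proof.
have -> : (-1) ^+ k = ((-1) ^+ k)%:P :> {poly R} by rewrite polyC_exp polyCN polyC1.
exact: expandsC.
Qed.

Lemma expandsD K f g p q :
  expands K f p -> expands K g q -> expands K (f \+ g) (p + q).
Proof.
move=> [r rb fp] [s sb gq]; exists (r \+ s); first exact: bounded_dnbhsD.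
near=> h.
have -> : (f \+ g) h = (p.[h] + h ^+ K * r h) + (q.[h] + h ^+ K * s h).
  by congr (_ + _); near: h.
by rewrite /= hornerD mulrDr addrACA.
Unshelve. all: by end_near. Qed.

Lemma expandsM K f g p q :
  expands K f p -> expands K g q -> expands K (f \* g) (p * q).
Proof.
move=> [r rb fp] [s sb gq].
exists ((horner p \* s) \+ ((r \* horner q) \+ ((fun h => h ^+ K) \* (r \* s)))).
  apply: bounded_dnbhsD; first exact/bounded_dnbhsM/sb/bounded_dnbhs_poly.
  apply: bounded_dnbhsD; first exact/bounded_dnbhsM/bounded_dnbhs_poly.
  by apply: bounded_dnbhsM; [exact: bounded_dnbhsX|exact: bounded_dnbhsM].
near=> h.
have -> : (f \* g) h = (p.[h] + h ^+ K * r h) * (q.[h] + h ^+ K * s h).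
  by congr (_ * _); near: h.
by rewrite /= hornerM; ring.
Unshelve. all: by end_near. Qed.

Lemma expands_sum K (I : Type) (s : seq I) (F : I -> R -> R) (P : I -> {poly R}) :
  (forall i, expands K (F i) (P i)) ->
  expands K (fun h => \sum_(i <- s) F i h) (\sum_(i <- s) P i).
Proof.
move=> FP; elim: s => [|i s IHs].
  by rewrite big_nil -polyC0; under eq_fun do rewrite big_nil; exact: expandsC.
by rewrite big_cons; under eq_fun do rewrite big_cons; exact: expandsD.
Qed.

Lemma expands_prod K (I : Type) (s : seq I) (F : I -> R -> R) (P : I -> {poly R}) :
  (forall i, expands K (F i) (P i)) ->
  expands K (fun h => \prod_(i <- s) F i h) (\prod_(i <- s) P i).
Proof.
move=> FP; elim: s => [|i s IHs].
  by rewrite big_nil -polyC1; under eq_fun do rewrite big_nil; exact: expandsC.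
by rewrite big_cons; under eq_fun do rewrite big_cons; exact: expandsM.
Qed.

Lemma expands_det K n (M : R -> 'M[R]_n) (P : 'M[{poly R}]_n) :
  (forall i j, expands K (fun h => M h i j) (P i j)) ->
  expands K (fun h => \det (M h)) (\det P).
Proof.
move=> MP; rewrite /determinant; apply: expands_sum => s.
apply: expandsM; last exact: expands_prod.
exact: expands_sign.
Qed.

Lemma expands_adj K n (M : R -> 'M[R]_n) (P : 'M[{poly R}]_n) i j :
  (forall i j, expands K (fun h => M h i j) (P i j)) ->
  expands K (fun h => (\adj (M h)) i j) ((\adj P) i j).
Proof.
move=> MP; rewrite mxE; under eq_fun do rewrite mxE.
apply: expandsM; last first.
  by apply: expands_det => k l; rewrite !mxE; under eq_fun do rewrite !mxE.
exact: expands_sign.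
Qed.

Lemma bounded_dnbhs_eq0 k r p : bounded_dnbhs r ->
  (\forall h \near (0 : R)^', p.[h] = h ^+ k.+1 * r h) -> p.[0] = 0.
Proof.
move=> rb ph; have [C /= rC] := bounded_dnbhsM (bounded_dnbhsX k) rb.
have p0 : p.[h] @[h --> (0 : R)^'] --> p.[0].
  by apply: cvg_within_filter; exact: continuous_horner.
suff : p.[h] @[h --> (0 : R)^'] --> (0 : R) by exact: (cvg_unique _ p0).
apply/cvgr0Pnorm_le => e e0; near=> h.
have -> : p.[h] = h ^+ k.+1 * r h by near: h.
rewrite exprS -mulrA normrM.
have hC : `|h ^+ k * r h| <= `|C| + 1.
  rewrite (@le_trans _ _ C) ?(le_trans (ler_norm C)) ?lerDl//.
  by near: h.
rewrite (le_trans (ler_wpM2l _ hC))// -ler_pdivlMr ?ltr_wpDl//.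
by near: h; apply: dnbhs0_le; rewrite divr_gt0 ?ltr_wpDl.
Unshelve. all: by end_near. Qed.

Lemma expands_unique K f p q : expands K f p -> expands K f q ->
  ('X^K %| p - q)%R.
Proof.
move=> [r rb fp] [s sb fq].
have [u ub pq] : exists2 u, bounded_dnbhs u &
    \forall h \near (0 : R)^', (p - q).[h] = h ^+ K * u h.
  exists (s \+ (fun h => -1 * r h)).
    apply: bounded_dnbhsD => //; apply: bounded_dnbhsM => //.
    by exists 1; near=> h; rewrite normrN1.
  near=> h; rewrite hornerD hornerN /= mulN1r.
  have fph : f h = p.[h] + h ^+ K * r h by near: h.
  have fqh : f h = q.[h] + h ^+ K * s h by near: h.
  by apply: (eq_of_sub_eq (etrans (esym fph) fqh)); ring.
move: (p - q) pq => {fp fq}{p q} p; elim: K p => [|K IHK] p ph.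
  by rewrite expr0 dvd1p.
have p0 : root p 0 by rewrite /root (bounded_dnbhs_eq0 ub ph).
have /dvdpP[q pE] : ('X %| p)%R by rewrite -['X]subr0 -polyC0 dvdp_XsubCl.
rewrite pE exprSr dvdp_mul2r ?polyX_eq0//; apply: IHK; near=> h.
have h0 : h != 0 by near: h; exact: nbhs_dnbhs_neq.
have qh : p.[h] = q.[h] * h by rewrite pE hornerM hornerX.
by apply: (mulIf h0); rewrite -qh mulrAC -exprSr; near: h.
Unshelve. all: by end_near. Qed.

Lemma expands_neq0 K f p : (0 < K)%N -> expands K f p -> p.[0] != 0 ->
  \forall h \near (0 : R)^', f h != 0.
Proof.
case: K => // K _ [r rb fp] p0.
have [C /= rC] := bounded_dnbhsM (bounded_dnbhsX K) rb.
have pcont : p.[h] @[h --> (0 : R)^'] --> p.[0].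
  by apply: cvg_within_filter; exact: continuous_horner.
have e0 : 0 < `|p.[0]| / 2 by rewrite divr_gt0// normr_gt0.
have near2 : \forall h \near (0 : R)^', `|p.[0] - p.[h]| < `|p.[0]| / 2.
  by move/cvgrPdist_lt : pcont => /(_ _ e0).
near=> h.
have -> : f h = p.[h] + h ^+ K.+1 * r h by near: h.
rewrite exprS -mulrA.
have h1 : `|h * (h ^+ K * r h)| < `|p.[0]| / 2.
  have hC : `|h ^+ K * r h| <= `|C| + 1.
    rewrite (@le_trans _ _ C) ?(le_trans (ler_norm C)) ?lerDl//.
    by near: h.
  rewrite normrM (le_lt_trans (ler_wpM2l _ hC))// -ltr_pdivlMr ?ltr_wpDl//.
  by near: h; apply: dnbhs0_lt; rewrite divr_gt0 ?ltr_wpDl.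
have h2 : `|p.[0] - p.[h]| < `|p.[0]| / 2 by near: h.
apply/eqP => E.
have : `|p.[0]| < `|p.[0]|.
  rewrite [X in _ < X](splitr `|p.[0]|); apply: le_lt_trans (ltrD h2 h1).
  apply: le_trans (ler_normB _ _).
  by rewrite -addrA -opprD E subr0.
by rewrite ltxx.
Unshelve. all: by end_near. Qed.

(** Losing [o] orders of precision is harmless, as [K] is arbitrary. *)
Lemma expands_divX K o f p : expands (K + o) f ('X^o * p) ->
  expands K (fun h => f h / h ^+ o) p.
Proof.
move=> [r rb fp]; exists r => //; near=> h.
have h0 : h != 0 by near: h; exact: nbhs_dnbhs_neq.
have -> : f h = ('X^o * p).[h] + h ^+ (K + o) * r h by near: h.
have ho : h ^+ o != 0 by exact: expf_neq0.
rewrite hornerM hornerXn exprD [_ ^+ K * _]mulrC -mulrA -mulrDr.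
by rewrite mulrC mulKf.
Unshelve. all: by end_near. Qed.

End Expansions.

Section Taylor.
Context {R : realType}.

(** Taylor's formula for a function given with all its derivatives [fs n]. *)
(** By induction on the order: the derivative of the remainder is the remainder
    of the derivative, and the mean value inequality integrates the bound. *)
Lemma taylor_bound (fs : nat -> R -> R) (t : R) (K : nat) :
  (\forall s \near t, forall n, is_derive (s : R) 1 (fs n) (fs n.+1 s)) ->
  forall n, exists C e, [/\ 0 <= C, 0 < e & forall h, `|h| < e ->
    `|fs n (t + h) - (\poly_(i < K) (fs (n + i)%N t / i`!%:R)).[h]|
       <= C * `|h| ^+ K].
Proof.
move=> /nbhs_ballP[e0 /= e00 dfs].
have dfs' n (h : R) : `|h| < e0 -> is_derive h 1 (fun x => fs n (t + x)) (fs n.+1 (t + h)).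
  move=> he.
  have := @is_derive1_comp R (fs n) (fun x => t + x) h (fs n.+1 (t + h)) 1.
  rewrite mulr1; apply.
  - apply: dfs; rewrite /ball /= opprD addrA subrr sub0r normrN.
    exact: he.
  - by apply: is_derive_eq; rewrite add0r mulr1.
elim: K => [|K IHK] n.
  have /cvgrPdist_lt/(_ 1 ltr01)/nbhs_ballP[e /= e1 fe] :
      {for 0, continuous (fun x => fs n (t + x))}.
    apply: differentiable_continuous; apply/derivable1_diffP.
    by have [] := dfs' n 0; rewrite ?normr0.
  exists (`|fs n t| + 1), e; split; rewrite ?addr_ge0// => h he.
  rewrite poly_def big_ord0 horner0 subr0 expr0 mulr1.
  have := fe h; rewrite /ball /= sub0r normrN addr0 => /(_ he) fh.
  rewrite (_ : fs n (t + h) = fs n t - (fs n t - fs n (t + h))); last first.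
    by rewrite subKr.
  by rewrite (le_trans (ler_normB _ _))// lerD2l ltW.
have [C [e [C0 e1 IH]]] := IHK n.+1.
exists C, (Num.min e0 e); split => //; first by rewrite lt_min e00.
move=> h; rewrite lt_min => /andP[he0 he].
pose P := \poly_(i < K.+1) (fs (n + i)%N t / i`!%:R).
pose Q := \poly_(i < K) (fs (n.+1 + i)%N t / i`!%:R).
have dP : P^`() = Q.
  apply/polyP => i; rewrite coef_deriv !coef_poly ltnS; case: ifP; last by rewrite mul0rn.
  move=> iK; rewrite addSnnS factS natrM invfM -[LHS]mulr_natr mulrA mulrAC.
  by rewrite mulfVK// pnatr_eq0.
pose phi x := fs n (t + x) - P.[x].
have dphi (x : R) : `|x| < e0 -> is_derive x 1 phi (fs n.+1 (t + x) - Q.[x]).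
  by move=> xe; rewrite -dP; apply: is_deriveB; exact: dfs'.
have phi0 : phi 0 = 0.
  by rewrite /phi addr0 horner_coef0 coef_poly /= addn0 fact0 divr1 subrr.
have bnd x y : x <= y -> `|x| <= `|h| -> `|y| <= `|h| ->
    `|phi y - phi x| <= C * `|h| ^+ K * (y - x).
  move=> xy xh yh.
  have inseg c : x <= c <= y -> `|c| <= `|h|.
    move=> /andP[xc cy]; rewrite ler_norml; apply/andP; split.
      by move: xh; rewrite ler_norml => /andP[+ _]; move/le_trans; apply.
    by move: yh; rewrite ler_norml => /andP[_ +]; exact: le_trans.
  have [||c] := @MVT_segment R phi (fun x => fs n.+1 (t + x) - Q.[x]) x y xy.
  - move=> c; rewrite in_itv /= => /andP[xc cy]; apply: dphi.
    by rewrite (le_lt_trans _ he0)// inseg// !ltW.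
  - apply: derivable_within_continuous => c; rewrite in_itv /= => xcy.
    have ce : `|c| < e0 by rewrite (le_lt_trans _ he0)// inseg.
    by have [] := dphi c ce.
  rewrite in_itv /= => /inseg ch ->; rewrite normrM [`|y - x|]ger0_norm ?subr_ge0//.
  apply: ler_wpM2r; first by rewrite subr_ge0.
  apply: le_trans (IH c _) _; first exact: le_lt_trans ch he.
  by apply: ler_wpM2l => //; apply: lerXn2r; rewrite ?nnegrE.
rewrite -/P -/(phi h) exprSr mulrA.
have [h0|h0] := leP 0 h.
  have := bnd 0 h h0; rewrite normr0 normr_ge0 lexx phi0 !subr0 => /(_ isT isT).
  by rewrite {3}(ger0_norm h0).
have := bnd h 0 (ltW h0); rewrite normr0 normr_ge0 lexx phi0 !sub0r normrN.
by move=> /(_ isT isT); rewrite {3}(ltr0_norm h0).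
Qed.

Lemma taylor_expands (fs : nat -> R -> R) (t : R) (K : nat) :
  (\forall s \near t, forall n, is_derive (s : R) 1 (fs n) (fs n.+1 s)) ->
  expands K (fun h => fs 0%N (t + h)) (\poly_(i < K) (fs i t / i`!%:R)).
Proof.
move=> /(@taylor_bound fs t K)/(_ 0%N)[C [e [C0 e0 Ce]]].
pose P := \poly_(i < K) (fs i t / i`!%:R).
exists (fun h => (fs 0%N (t + h) - P.[h]) / h ^+ K).
  exists C; near=> h.
  have h0 : h != 0 by near: h; exact: nbhs_dnbhs_neq.
  rewrite normrM normfV normrX ler_pdivrMr ?exprn_gt0 ?normr_gt0//.
  by apply: Ce; near: h; exact: dnbhs0_lt.
near=> h.
have h0 : h != 0 by near: h; exact: nbhs_dnbhs_neq.
by rewrite mulrC divfK ?expf_neq0// [RHS]addrC subrK.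
Unshelve. all: by end_near. Qed.

End Taylor.
(** * The trace of the infinitesimal cross-ratio *)

Section LinearFunctions.
Context {R : realType}.

Lemma linfunE (U V : vectType R) (f : U -> V) : linear f -> linfun f =1 f.
Proof.
move=> lf.
pose F : {linear U -> V} :=
  HB.pack f (GRing.isSemilinear.Build R U V _ f (GRing.semilinear_linear lf)).
exact: (lfunE F).
Qed.

Lemma lftrace_rank1 (U : vectType R) (f : 'End(U)) (phi : 'Hom(U, R^o)) (w : U) :
  (forall u, f u = (phi u : R) *: w) -> lftrace f = phi w.
Proof.
move=> fE; rewrite /lftrace /mxtrace.
rewrite {1}(coord_vbasis (memvf w)) linear_sum; apply: eq_bigr => i _.
rewrite /passmx.mxof mxE /= passmx.vecof_delta fE linearZ mxE linearZ /=.
exact: mulrC.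
Qed.

End LinearFunctions.

Section Symplectic.
Context {R : realType} {W : vectType R} (sigma : {skew_symmetric W}).

Lemma sigmaC u v : sigma u v = - sigma v u.
Proof. by rewrite hermC expr1 mulN1r. Qed.

Lemma sigmaDl u v w : sigma (u + v) w = sigma u w + sigma v w.
Proof. exact: linearDl. Qed.

Lemma sigmaZl a u w : sigma (a *: u) w = a * sigma u w.
Proof. exact: linearZl_LR. Qed.

Lemma sigma_suml (I : finType) (F : I -> W) w :
  sigma (\sum_i F i) w = \sum_i sigma (F i) w.
Proof. exact: linear_sumlz. Qed.

Lemma sigmaDr u v w : sigma u (v + w) = sigma u v + sigma u w.
Proof. by rewrite ![sigma u _]sigmaC sigmaDl opprD. Qed.

Lemma sigmaZr a u w : sigma u (a *: w) = a * sigma u w.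
Proof. by rewrite ![sigma u _]sigmaC sigmaZl mulrN. Qed.

Lemma sigma_sumr (I : finType) (F : I -> W) w :
  sigma w (\sum_i F i) = \sum_i sigma w (F i).
Proof.
by rewrite sigmaC sigma_suml -sumrN; apply: eq_bigr => i _; rewrite -sigmaC.
Qed.

Definition sigmal (v : W) : 'Hom(W, R^o) := linfun (fun u => sigma u v : R^o).

Lemma sigmalE v u : sigmal v u = sigma u v.
Proof. by apply: linfunE => a x y; rewrite sigmaDl sigmaZl. Qed.

(** Only linear functionals of curves are differentiated, so the product rule
    goes through coordinates in a fixed basis. *)
Lemma is_derive_sigma (u l : R -> W) t du dl :
  is_vderive u t du -> is_vderive l t dl ->
  is_derive t 1 (fun s => sigma (u s) (l s)) (sigma du (l t) + sigma (u t) dl).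
Proof.
move=> hu hl; pose b := vbasis {:W}.
pose c i : 'Hom(W, R^o) := linfun (fun v => coord b i v : R^o).
have cE i v : c i v = coord b i v by apply: linfunE => a x y; rewrite linearP.
have lE v : v = \sum_i c i v *: b`_i.
  rewrite {1}(coord_vbasis (memvf v)); apply: eq_bigr => i _.
  by rewrite cE.
have -> : (fun s => sigma (u s) (l s))
    = \sum_i ((fun s => c i (l s) : R) * (fun s => sigmal b`_i (u s) : R)).
  apply/funext => s; rewrite fct_sumE {1}(lE (l s)) sigma_sumr.
  by apply: eq_bigr => i _; rewrite sigmaZr -sigmalE.
have Hd i : is_derive t 1 ((fun s => c i (l s) : R) * (fun s => sigmal b`_i (u s) : R))
    (c i (l t) * sigmal b`_i du + sigmal b`_i (u t) * c i dl).
  have ? := hl (c i); have ? := hu (sigmal b`_i).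
  exact: is_deriveM.
apply: is_derive_eq.
rewrite big_split /= {2}(lE (l t)) {2}(lE dl) !sigma_sumr.
congr (_ + _); apply: eq_bigr => i _; rewrite sigmaZr sigmalE//.
exact: mulrC.
Qed.

End Symplectic.

Section Frame.
Context {R : realType} {W : vectType R} (sigma : {skew_symmetric W}) {m : nat}.
Variables (E F : 'I_m -> W).
Hypothesis EF : darboux sigma E F.
Let L : {vspace W} := <<[seq E i | i : 'I_m]>>%VS.

Lemma mem_frame i : E i \in L.
Proof. by apply: memv_span; apply/mapP; exists i => //; rewrite mem_enum. Qed.

Lemma frame_coord u : u \in L -> u = \sum_i sigma (F i) u *: E i.
Proof.
case: EF => _ _ _ FE.
pose T : 'End(W) := linfun (fun u : W => \sum_i sigma (F i) u *: E i).
have TE v : T v = \sum_i sigma (F i) v *: E i.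
  apply: linfunE => a x y; rewrite scaler_sumr -big_split /=.
  by apply: eq_bigr => i _; rewrite sigmaDr sigmaZr scalerDl scalerA.
suff /fixedSpacesP LT : (L <= fixedSpace T)%VS by move=> /LT; rewrite TE.
apply/span_subvP => _ /mapP[i _ ->]; apply/fixedSpaceP; rewrite TE.
rewrite (bigD1 i)//= FE eqxx scale1r big1 ?addr0// => j ji.
by rewrite FE (negbTE ji) scale0r.
Qed.

Lemma frame_isotropic u v : u \in L -> v \in L -> sigma u v = 0.
Proof.
case: EF => _ EE _ _ /frame_coord -> /frame_coord ->.
rewrite sigma_suml big1// => i _; rewrite sigma_sumr big1// => j _.
by rewrite sigmaZl sigmaZr EE !mulr0.
Qed.

End Frame.

Section Velocity.
Context {R : realType} {W : vectType R} (sigma : {skew_symmetric W}) {n : nat}.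

(** The velocity is nonzero only along [E_n], since every other [E_j] has its
    derivative in the curve. *)
Lemma velocity_frame (eps : bool) (Lam : R -> {vspace W}) (E F : 'I_n.+1 -> R -> W) t :
  (\forall s \near t, darboux sigma (E ^~ s) (F ^~ s) /\
     Lam s = <<[seq E i s | i : 'I_n.+1]>>%VS) ->
  (forall i j : 'I_n.+1, j = i.+1 :> nat -> is_vderive (E i) t (E j t)) ->
  is_vderive (E ord_max) t ((-1) ^+ eps *: F ord_max t) ->
  \dim (limg (velocity sigma Lam t)) = 1%N ->
  forall u v, velocity sigma Lam t u v =
    (-1) ^+ eps * (sigma (F ord_max t) (vsval u) * sigma (F ord_max t) (vsval v)).
Proof.
move=> frames dE dEn rk.
have [frame_t Lt] := nbhs_singleton frames.
have /= [V_sym V_diag] : is_velocity sigma (velocity sigma Lam t).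
  (* Otherwise the velocity would be the default value 0, of rank 0. *)
  apply: contrapT => noV; suff V0 : velocity sigma Lam t = 0.
    have : limg (velocity sigma Lam t) = 0%VS.
      by apply/eqP; rewrite V0 -subv0; apply/subvP => _ /memv_imgP[u _ ->];
         rewrite lfunE /= mem0v.
    by move=> E0; move: rk; rewrite E0 dimv0.
  rewrite /velocity; case: xgetP => // V _ Vv.
  by exfalso; apply: noV; rewrite /velocity; apply: xgetI Vv.
set V := velocity _ _ _ in V_sym V_diag *.
pose a w := sigma (F ord_max t) w.
have [_ EE _ FE] := frame_t.
(* Differentiating [sigma (E j s) (l s) = 0] trades the derivative of the
   arbitrary curve [l] for that of [E j]; polarization comes afterwards. *)
have diag u : V u u = (-1) ^+ eps * a (vsval u) ^+ 2.
  have [l [d [_ lL lt dl ->]]] := V_diag u.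
  have ltL : l t \in Lam t by rewrite lt; exact: subvsP.
  have dsig j dj : is_vderive (E j) t dj -> sigma d (E j t) = sigma dj (l t).
    move=> dEj; have D := is_derive_sigma sigma dEj dl.
    have : is_derive t 1 (fun s => sigma (E j s) (l s)) 0.
      apply: near_eq_is_derive (is_derive_cst (0 : R) t 1).
      near=> s.
      have [fs Ls] : darboux sigma (E ^~ s) (F ^~ s) /\
        Lam s = <<[seq E i s | i : 'I_n.+1]>>%VS by near: s.
      have lsL : l s \in Lam s by near: s.
      by rewrite (frame_isotropic fs)//; [exact: mem_frame|rewrite -Ls].
    case=> _; have [_ ->] := D => /eqP; rewrite addr_eq0 [sigma (E j t) d]sigmaC.
    by rewrite opprK => /eqP.
  rewrite Lt in ltL.
  rewrite {1}(frame_coord frame_t ltL) sigma_sumr (bigD1 ord_max)//= big1 ?addr0.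
    by rewrite sigmaZr (dsig _ _ dEn) sigmaZl -lt mulrCA expr2.
  move=> j jn; rewrite sigmaZr.
  have jn' : (j.+1 < n.+1)%N.
    by rewrite ltnS ltn_neqAle -ltnS ltn_ord andbT; apply: contra jn => /eqP jn;
       apply/eqP/val_inj.
  rewrite (dsig j (E (Ordinal jn') t)); last exact: dE.
  by rewrite (frame_isotropic frame_t) ?mulr0//; exact: mem_frame.
move=> u v.
have VD : V (u + v) = V u + V v by exact: linearD.
have := diag (u + v); rewrite VD add_lfunE [V u _]linearD [V v _]linearD /=.
rewrite !diag (V_sym v u) /a sigmaDr => Huv.
have : 2 * V u v = 2 * ((-1) ^+ eps * (a (vsval u) * a (vsval v))).
  by apply: (eq_of_sub_eq Huv); rewrite /a; ring.
by apply: mulfI; rewrite pnatr_eq0.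
Unshelve. all: by end_near. Qed.

End Velocity.

Section CrossRatio.
Context {R : realType} {W : vectType R} (sigma : {skew_symmetric W}) {n : nat}.
Variables (L0 L1 : {vspace W}) (E0 F0 E1 F1 : 'I_n.+1 -> W).
Hypothesis EF0 : darboux sigma E0 F0.
Hypothesis EF1 : darboux sigma E1 F1.
Hypothesis L0E : L0 = <<[seq E0 i | i : 'I_n.+1]>>%VS.
Hypothesis L1E : L1 = <<[seq E1 i | i : 'I_n.+1]>>%VS.
(* The rows of the expanded matrix carry no signs, its columns do. *)
Variables (kappa : 'I_n.+1 -> R).
Hypothesis kappa2 : forall j, kappa j * kappa j = 1.

Definition gram : 'M[R]_n.+1 := \matrix_(i, j) (kappa j * sigma (E0 i) (E1 j)).
Hypothesis gram_unit : gram \in unitmx.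

Lemma pairingE (A B : {vspace W}) (v : subvs_of B) (u : subvs_of A) :
  pairing sigma A B v u = sigma (vsval v) (vsval u).
Proof.
have inner (w : subvs_of B) : linear (fun u : subvs_of A => sigma (vsval w) (vsval u) : R^o).
  by move=> a x y; rewrite [vsval (_ *: _ + _)]linearP sigmaDr sigmaZr.
rewrite /pairing linfunE; first by rewrite linfunE//; exact: inner.
move=> a x y; apply/lfunP => z; rewrite add_lfunE scale_lfunE.
rewrite !(linfunE (inner _)) /=.
by rewrite sigmaDl sigmaZl.
Qed.

Lemma gram_inj (c : 'I_n.+1 -> R) :
  (forall j, sigma (\sum_i c i *: E0 i) (E1 j) = 0) -> forall i, c i = 0.
Proof.
move=> c0; pose v : 'rV[R]_n.+1 := \row_i c i.
suff v0 : v = 0 by move=> i; move/rowP/(_ i): v0; rewrite !mxE.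
rewrite -[v](mulmxK gram_unit) (_ : v *m gram = 0) ?mul0mx//.
apply/rowP => j; rewrite !mxE.
have -> : \sum_k v 0 k * gram k j = kappa j * sigma (\sum_i c i *: E0 i) (E1 j).
  rewrite sigma_suml mulr_sumr; apply: eq_bigr => k _.
  by rewrite !mxE sigmaZl mulrCA.
by rewrite c0 mulr0.
Qed.

Lemma gram_injr (c : 'I_n.+1 -> R) :
  (forall i, sigma (E0 i) (\sum_j c j *: E1 j) = 0) -> forall j, c j = 0.
Proof.
move=> c0; pose v : 'cV[R]_n.+1 := \col_j (kappa j * c j).
suff v0 : v = 0.
  move=> j; move/colP/(_ j): v0; rewrite !mxE => /(congr1 (fun x => kappa j * x)).
  by rewrite mulrA kappa2 mul1r mulr0.
rewrite -[v](mulKmx gram_unit) (_ : gram *m v = 0) ?mulmx0//.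
apply/colP => i; rewrite !mxE -[RHS](c0 i) sigma_sumr; apply: eq_bigr => k _.
by rewrite !mxE sigmaZr mulrACA kappa2 mul1r mulrC.
Qed.

Lemma gram_transversal : (L0 :&: L1 = 0)%VS.
Proof.
apply/eqP; rewrite -subv0; apply/subvP => u; rewrite memv_cap memv0.
rewrite L0E L1E => /andP[uL0 uL1].
rewrite (frame_coord EF0 uL0) big1// => i _.
rewrite (gram_inj (c := fun i => sigma (F0 i) u)) ?scale0r// => j.
by rewrite -(frame_coord EF0 uL0) (frame_isotropic EF1)//; exact: mem_frame.
Qed.

Variables (s : R) (V0 : form_on L0) (V1 : form_on L1).
Hypothesis s2 : s * s = 1.
Hypothesis V0E : forall u v, V0 u v =
  s * (sigma (F0 ord_max) (vsval u) * sigma (F0 ord_max) (vsval v)).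
Hypothesis V1E : forall u v, V1 u v =
  s * (sigma (F1 ord_max) (vsval u) * sigma (F1 ord_max) (vsval v)).

(** The velocities have rank one, so the cross-ratio has rank one as well; its
    trace only involves the preimages under the two pairings of the linear form
    that spans the image of each velocity. *)
Lemma lftrace_cross_ratio :
  lftrace (cross_ratio sigma V0 V1) = - (invmx gram ord_max ord_max) ^+ 2.
Proof.
have [_ EE0 _ FE0] := EF0; have [_ EE1 _ FE1] := EF1.
have memE0 i : E0 i \in L0 by rewrite L0E mem_frame.
have memE1 i : E1 i \in L1 by rewrite L1E mem_frame.
pose k := kappa ord_max.
pose w0 : W := \sum_i (k * invmx gram ord_max i) *: E0 i.
pose v1 : W := \sum_j (- (kappa j * invmx gram j ord_max)) *: E1 j.
have w0L : w0 \in L0 by apply: memv_suml => i _; rewrite memvZ.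
have v1L : v1 \in L1 by apply: memv_suml => i _; rewrite memvZ.
(* [w0] and [v1] are the preimages, under the two pairings, of the linear forms
   whose squares are the velocities. *)
have w0E x : x \in L1 -> sigma w0 x = sigma (F1 ord_max) x.
  rewrite L1E => /(frame_coord EF1) ->; rewrite !sigma_sumr; apply: eq_bigr => j _.
  rewrite !sigmaZr FE1; congr (_ * _).
  have -> : sigma w0 (E1 j) = k * kappa j * (invmx gram *m gram) ord_max j.
    rewrite sigma_suml [X in _ * X]mxE mulr_sumr; apply: eq_bigr => i _.
    rewrite sigmaZl [gram i j]mxE -[in LHS](mul1r (sigma (E0 i) (E1 j))).
    by rewrite -(kappa2 j); ring.
  rewrite mulVmx// mxE; case: eqP => [<-|_]; last by rewrite mulr0.
  by rewrite mulr1 kappa2.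
have v1E x : x \in L0 -> sigma v1 x = sigma (F0 ord_max) x.
  rewrite L0E => /(frame_coord EF0) ->; rewrite !sigma_sumr; apply: eq_bigr => i _.
  rewrite !sigmaZr FE0; congr (_ * _).
  have -> : sigma v1 (E0 i) = (gram *m invmx gram) i ord_max.
    rewrite sigma_suml mxE; apply: eq_bigr => j _.
    by rewrite sigmaZl sigmaC mulrNN [gram i j]mxE; ring.
  by rewrite mulmxV// mxE eq_sym.
have F1v1 : sigma (F1 ord_max) v1 = - (k * invmx gram ord_max ord_max).
  rewrite sigma_sumr (bigD1 ord_max)//= big1 ?addr0.
    by rewrite sigmaZr FE1 eqxx mulr1.
  by move=> j jn; rewrite sigmaZr FE1 eq_sym (negbTE jn) mulr0.
have F0w0 : sigma (F0 ord_max) w0 = k * invmx gram ord_max ord_max.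
  rewrite sigma_sumr (bigD1 ord_max)//= big1 ?addr0.
    by rewrite sigmaZr FE0 eqxx mulr1.
  by move=> j jn; rewrite sigmaZr FE0 eq_sym (negbTE jn) mulr0.
pose a : 'Hom(subvs_of L0, R^o) := linfun (fun u => sigma (F0 ord_max) (vsval u) : R^o).
have aE u : a u = sigma (F0 ord_max) (vsval u).
  by apply: linfunE => c x y; rewrite [vsval (_ *: _ + _)]linearP sigmaDr sigmaZr.
have inj10 : lker (pairing sigma L1 L0) == 0%VS.
  rewrite -subv0; apply/subvP => u; rewrite memv_ker memv0 => /eqP u0.
  have uL : vsval u \in <<[seq E0 i | i : 'I_n.+1]>>%VS by rewrite -L0E; exact: subvsP.
  apply/eqP/val_inj => /=; rewrite (frame_coord EF0 uL) big1// => i _.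
  rewrite (gram_inj (c := fun i => sigma (F0 i) (vsval u))) ?scale0r// => j.
  rewrite -(frame_coord EF0 uL) -(vsprojK (memE1 j)).
  by rewrite -pairingE u0 zero_lfunE.
have inj01 : lker (pairing sigma L0 L1) == 0%VS.
  rewrite -subv0; apply/subvP => u; rewrite memv_ker memv0 => /eqP u0.
  have uL : vsval u \in <<[seq E1 i | i : 'I_n.+1]>>%VS by rewrite -L1E; exact: subvsP.
  apply/eqP/val_inj => /=; rewrite (frame_coord EF1 uL) big1// => i _.
  rewrite (gram_injr (c := fun i => sigma (F1 i) (vsval u))) ?scale0r// => j.
  rewrite -(frame_coord EF1 uL) -(vsprojK (memE0 j)) sigmaC.
  by rewrite -pairingE u0 zero_lfunE oppr0.
have V0a u : V0 u = pairing sigma L0 L1 ((s * a u) *: vsproj L1 v1).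
  apply/lfunP => x; rewrite V0E linearZ scale_lfunE pairingE vsprojK// v1E ?subvsP//.
  by rewrite aE; exact: mulrA.
have V1v : V1 (vsproj L1 v1)
    = pairing sigma L1 L0 ((s * sigma (F1 ord_max) v1) *: vsproj L0 w0).
  apply/lfunP => x; rewrite V1E linearZ scale_lfunE pairingE !vsprojK// w0E ?subvsP//.
  exact: mulrA.
rewrite (@lftrace_rank1 _ _ _ a (sigma (F1 ord_max) v1 *: vsproj L0 w0)).
  rewrite aE [vsval _]linearZ /= sigmaZr vsprojK// F0w0 F1v1 mulNr mulrACA kappa2.
  by rewrite mul1r expr2.
move=> u; rewrite /cross_ratio !comp_lfunE V0a lker0_lfunK//.
have -> : V1 ((s * a u) *: vsproj L1 v1) = pairing sigma L1 L0
    (((s * a u) * (s * sigma (F1 ord_max) v1)) *: vsproj L0 w0).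
  by rewrite linearZ /= V1v -linearZ /= scalerA.
rewrite lker0_lfunK// !scalerA; congr (_ *: _).
by rewrite mulrACA s2 mul1r.
Qed.

End CrossRatio.
(** * Inversion of the differential relations *)

Section Inversion.
Context {R : realType}.

(** Identifies all derivatives at once from a candidate family [fs]. *)
Lemma derive1n_seq (U : set R) (f : R -> R) (fs : nat -> R -> R) : open U ->
  (forall s, U s -> f s = fs 0%N s) ->
  (forall s d, U s -> is_derive s 1 (fs d) (fs d.+1 s)) ->
  forall d s, U s -> derive1n d f s = fs d s /\ derivable (derive1n d f) s 1.
Proof.
move=> oU f0 dfs; elim=> [|d IHd] s Us.
  have nearf : \forall x \near s, fs 0%N x = f x.
    by apply: filterS (open_nbhs_nbhs (conj oU Us)) => x /f0.
  split; first by rewrite derive1n0 f0.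
  rewrite derive1n0; apply: near_eq_derivable nearf _.
  by have [] := dfs s 0%N Us.
have dE x : U x -> derive1n d.+1 f x = fs d.+1 x.
  move=> Ux; rewrite derive1nS derive1E.
  have [_ <-] := dfs x d Ux; apply: near_eq_derive.
  by apply: filterS (open_nbhs_nbhs (conj oU Ux)) => y /IHd[].
split; first exact: dE.
have nearf : \forall x \near s, fs d.+1 x = derive1n d.+1 f x.
  by apply: filterS (open_nbhs_nbhs (conj oU Us)) => x /dE.
apply: near_eq_derivable nearf _.
by have [] := dfs s d.+1 Us.
Qed.

(** A relation [b_r = T_r(lambda_0, ..., lambda_(r-1)) + c_r * lambda_r] is
    triangular, so it can be solved for the [lambda_r] one after the other; the
    derivatives of the [lambda_j] already found are total derivatives of their
    expressions in the [b_j]. *)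
Lemma triangular_inversion (T : nat -> dexp R) (c : nat -> R) N :
  (forall r, (r < N)%N ->
     [/\ c r != 0, dvars_lt r (T r) & deval (T r) (fun _ _ => 0) = 0]) ->
  exists S : nat -> dexp R,
    (forall r, (r < N)%N -> dvars_lt r (S r) /\ deval (S r) (fun _ _ => 0) = 0) /\
    forall (U : set R) (lam b : nat -> R -> R), open U ->
      (forall r d s, (r < N)%N -> U s -> derivable (derive1n d (b r)) s 1) ->
      (forall r s, (r < N)%N -> U s ->
         b r s = deval (T r) (jet lam s) + c r * lam r s) ->
      forall r s, (r < N)%N -> U s ->
        lam r s = (c r)^-1 * b r s + deval (S r) (jet b s).
Proof.
elim: N => [|N IHN] hT; first by exists (fun=> DCst 0); split.
have [r rN|S [hS IHS]] := IHN; first by apply: hT; exact: ltnW.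
have [cN TN TN0] := hT N (ltnSn N).
pose L j := DAdd (DMul (DCst (c j)^-1) (DVar j 0)) (S j).
have Lvars j : (j < N)%N -> dvars_lt N (L j).
  by move=> jN /=; rewrite jN (dvars_ltW (ltnW jN))// (hS j jN).1.
pose SN := DMul (DCst (- (c N)^-1)) (dsubst (fun j d => iter d (@dtotal R) (L j)) (T N)).
exists (fun r => if (r < N)%N then S r else SN); split.
  move=> r; rewrite ltnS leq_eqVlt => /orP[/eqP ->|rN]; last first.
    by rewrite rN; exact: hS.
  rewrite ltnn; split => /=.
    apply: dvars_lt_subst TN _ => j d jN.
    exact/dvars_lt_total/Lvars.
  rewrite deval_subst (@eq_deval _ _ N _ (fun _ _ => 0))// ?TN0 ?mulr0//.
  move=> j [|d] jN /=; first by rewrite mulr0 (hS j jN).2 addr0.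
  by rewrite deval_total_cst.
move=> U lam b oU db hb.
have lamE r s : (r < N)%N -> U s -> lam r s = deval (L r) (jet b s).
  move=> rN Us /=; apply: (IHS U) => // [j d x jN|j x jN].
    exact: db (ltnW jN).
  exact: hb (ltnW jN).
move=> r s; rewrite ltnS leq_eqVlt => /orP[/eqP ->|rN] Us; last first.
  by rewrite rN; exact: lamE.
rewrite ltnn /= deval_subst.
have -> : deval (T N) (fun j d => deval (iter d (@dtotal R) (L j)) (jet b s))
    = deval (T N) (jet lam s).
  apply: (eq_deval TN) => j d jN; apply/esym.
  have fs_der x d' : U x -> is_derive x 1
      (fun x => deval (iter d' (@dtotal R) (L j)) (jet b x))
      (deval (iter d'.+1 (@dtotal R) (L j)) (jet b x)).
    move=> Ux; apply: (@is_derive_deval _ _ N.+1) => [i e iN|]; first exact: db.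
    by apply: dvars_lt_total; apply: dvars_ltW (Lvars j jN).
  by have [] := derive1n_seq oU (fun x => @lamE j x jN) fs_der d Us.
rewrite hb//; field.
by [].
Qed.

End Inversion.

(** * Smooth functions *)

Section Smooth.
Context {R : realType}.

Lemma iter_derive_derive1n (f : R -> R) n :
  iter_derive (nseq n (1 : R)) f = derive1n n f.
Proof.
elim: n => [//|n IHn]; apply/funext => s.
rewrite derive1nS derive1E.
by rewrite -[LHS]/('D_1 (iter_derive (nseq n (1 : R)) f) s) IHn.
Qed.

Lemma smooth_at_derivable (f : R -> R) t : smooth_at f t ->
  \forall s \near t, forall n, derivable (derive1n n f) s 1.
Proof.
apply: filterS => s fs n; rewrite -iter_derive_derive1n.
exact/derivable1_diffP.
Qed.

(* The partial derivatives of [g] and its derivatives along the diagonal are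
   both derivatives along the affine line [a] of direction [v]. *)
Variables (a : R -> R * R) (v : R * R).
Hypothesis a_line : forall x h, a (h + x) = h *: v + a x.

Lemma derive_line (Phi : R * R -> R) x : 'D_1 (Phi \o a) x = 'D_v Phi (a x).
Proof.
rewrite /derive; set P := fun h => _; set Q := fun h => _.
suff -> : P = Q by [].
by apply/funext => h; rewrite /P /Q /= [_ *: 1]mulr1 a_line.
Qed.

Lemma derivable_line (Phi : R * R -> R) x :
  differentiable Phi (a x) -> derivable (Phi \o a) x 1.
Proof.
move=> dPhi; have : derivable Phi (a x) v by exact: diff_derivable.
rewrite /derivable.
set P := fun h => _; set Q := fun h => _.
suff -> : P = Q by [].
by apply/funext => h; rewrite /P /Q /= [_ *: 1]mulr1 a_line.
Qed.

Lemma derive1n_line (Phi : R * R -> R) n :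
  derive1n n (Phi \o a) = iter_derive (nseq n v) Phi \o a.
Proof.
elim: n => [//|n IHn]; apply/funext => x.
by rewrite derive1nS IHn derive1E derive_line.
Qed.

End Smooth.

Section RegularPart.
Context {R : realType}.
Variables (g : R -> R -> R) (t : R).
Hypothesis g_smooth : smooth_at (fun p : R * R => g p.1 p.2) (t, t).

Let G (p : R * R) : R := g p.1 p.2.

Let hline (s x h : R) : (h + x, s) = h *: ((1, 0) : R * R) + (x, s).
Proof. by congr pair; rewrite /= ?[_ *: 1]mulr1 // scaler0 add0r. Qed.

Let dline (x h : R) : (h + x, h + x) = h *: ((1, 1) : R * R) + (x, x).
Proof. by congr pair; rewrite /= [_ *: 1]mulr1. Qed.

Lemma derive1n_slice n s x : derive1n n (fun x => g x s) x
  = iter_derive (nseq n ((1, 0) : R * R)) G (x, s).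
Proof.
by have := derive1n_line (hline s) G n; move/(congr1 (fun f => f x)).
Qed.

Lemma derivable_slice : \forall s \near t, forall n,
  derivable (derive1n n (fun x => g x t)) s 1.
Proof.
have ct : (s, t) @[s --> t] --> (t, t).
  by apply: (@cvg_pair _ _ _ _ (nbhs t) (nbhs t)); [exact: cvg_id|exact: cvg_cst].
have : \forall s \near t, forall vs, differentiable (iter_derive vs G) (s, t).
  exact: ct _ g_smooth.
apply: filterS => s Gs n.
rewrite (funext (derive1n_slice n t)).
exact: (derivable_line (hline t)).
Qed.

(** Near [t] the function [beta g j] is, up to a constant factor, the restriction
    to the diagonal of an iterated partial derivative of [g]. *)
Lemma derivable_beta : \forall s \near t, forall j d,
  derivable (derive1n d (beta g j)) s 1.
Proof.
have cdiag x : (s, s) @[s --> x] --> ((x, x) : R * R).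
  by apply: (@cvg_pair _ _ _ _ (nbhs x) (nbhs x)); exact: cvg_id.
pose A := (fun y => forall vs, differentiable (iter_derive vs G) y)° : set (R * R).
have oA : open A by exact: open_interior.
have oU : open [set s | A (s, s)].
  have := @open_comp R (R * R)%type (fun s : R => (s, s)) A; apply => // s _.
  exact: cdiag.
have : \forall s \near t, A (s, s).
  exact: cdiag t _ (open_nbhs_nbhs (conj oA g_smooth)).
apply: filterS => s As j d.
pose fs d x := iter_derive (nseq d ((1, 1) : R * R) ++ nseq j ((1, 0) : R * R)) G (x, x)
  / j`!%:R.
have [] // := @derive1n_seq R [set s | A (s, s)] (beta g j) fs oU _ _ d s As.
  by move=> x _; rewrite /beta derive1n_slice.
move=> x e /= /interior_subset Gx.
pose Phi := iter_derive (nseq e ((1, 1) : R * R) ++ nseq j ((1, 0) : R * R)) G.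
have dPhi : is_derive x 1 (Phi \o (fun y => (y, y)))
    (iter_derive (nseq e.+1 ((1, 1) : R * R) ++ nseq j ((1, 0) : R * R)) G (x, x)).
  apply: DeriveDef.
    exact: (@derivable_line _ (fun y : R => (y, y)) _ dline Phi x (Gx _)).
  exact: (@derive_line _ (fun y : R => (y, y)) _ dline Phi x).
have -> : fs e = j`!%:R^-1 \*: (Phi \o (fun y => (y, y))).
  by apply/funext => y; rewrite /fs /= mulrC.
have -> : fs e.+1 x = j`!%:R^-1 *: (iter_derive
    (nseq e.+1 ((1, 1) : R * R) ++ nseq j ((1, 0) : R * R)) G (x, x)).
  by rewrite /fs mulrC.
exact: is_deriveZ.
Qed.

End RegularPart.
(** * Principal curvatures of a curve with a moving frame *)

Section ChainDerivative.
Context {R : realType}.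
Variables (n : nat) (eps : bool) (lam z : nat -> R -> R) (s : R).
Hypothesis dlam : forall j d, (j <= n)%N -> derivable (derive1n d (lam j)) s 1.
Hypothesis dz : forall p, (p <= n.*2.+1)%N -> is_derive s 1 (z p)
  (z p.+1 s + (if (n < p)%N
               then kap n eps p * lam (p - n.+1)%N s * z (n.*2.+1 - p)%N s else 0)).
Hypothesis z_last : z n.*2.+2 s = 0.

Definition chain_derive i k x : R :=
  \sum_(p < n.*2.+2) deval (cf n eps i k p) (jet lam x) * z p x.

(** The recursion defining [cf] is the product rule, after the shift [p + 1] and
    the reflection [2n+1-p] of the summation index. *)
Lemma is_derive_chain i k :
  is_derive s 1 (chain_derive i k) (chain_derive i k.+1 s).
Proof.
pose c p := deval (cf n eps i k p) (jet lam s).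
pose dc p := deval (dtotal (cf n eps i k p)) (jet lam s).
pose mu p := if (n < p)%N then kap n eps p * lam (p - n.+1)%N s else 0.
have Hp (p : 'I_n.*2.+2) : is_derive s 1
    ((fun x => deval (cf n eps i k p) (jet lam x)) * z p)
    (c p *: (z p.+1 s + mu p * z (n.*2.+1 - p)%N s) + z p s *: dc p).
  have ? : is_derive s 1 (fun x => deval (cf n eps i k p) (jet lam x)) (dc p).
    by apply: (@is_derive_deval _ _ n.+1) => [j d jn|]; [exact: dlam|exact: dvars_lt_cf].
  have pn : (p <= n.*2.+1)%N by rewrite -ltnS.
  have := dz pn => ?.
  apply: is_derive_eq; congr (_ *: (_ + _) + _).
  by rewrite /mu; case: ifP; rewrite ?mul0r.
have -> : chain_derive i k =
    \sum_(p < n.*2.+2) ((fun x => deval (cf n eps i k p) (jet lam x)) * z p).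
  by apply/funext => x; rewrite fct_sumE.
apply: is_derive_eq.
rewrite /chain_derive -/(c _).
have -> : \sum_(p < n.*2.+2) (c p *: (z p.+1 s + mu p * z (n.*2.+1 - p)%N s) + z p s *: dc p)
  = \sum_(p < n.*2.+2) dc p * z p s
    + (\sum_(p < n.*2.+2) c p * z p.+1 s
       + \sum_(p < n.*2.+2) c p * mu p * z (n.*2.+1 - p)%N s).
  rewrite -!big_split /=; apply: eq_bigr => p _.
  by rewrite /GRing.scale /=; ring.
have -> : \sum_(p < n.*2.+2) c p * z p.+1 s =
    \sum_(p < n.*2.+2) (if (p : nat) is p'.+1 then c p' else 0) * z p s.
  rewrite big_ord_recr /= z_last mulr0 addr0.
  by rewrite [RHS]big_ord_recl /= mul0r add0r; apply: eq_bigr.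
have -> : \sum_(p < n.*2.+2) c p * mu p * z (n.*2.+1 - p)%N s =
    \sum_(p < n.*2.+2) c (n.*2.+1 - p)%N * mu (n.*2.+1 - p)%N * z p s.
  rewrite (reindex_inj rev_ord_inj) /=; apply: eq_bigr => p _.
  rewrite subSS; congr (_ * z _ s).
  by have := ltn_ord p; lia.
rewrite -!big_split /=; apply: eq_bigr => p _ /=.
rewrite -!mulrDl; congr (_ * _); rewrite -/(dc _); congr (_ + (_ + _)).
  by case: (nat_of_ord p).
rewrite /mu; have := ltn_ord p => pn.
have [pn'|pn'] := leqP p n; last first.
  have np : (n < n.*2.+1 - p)%N = false by lia.
  by rewrite np mulr0.
have np : (n < n.*2.+1 - p)%N by lia.
rewrite np.
have -> : (n.*2.+1 - p - n.+1)%N = (n - p)%N by lia.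
by rewrite [RHS]mulrC.
Qed.

End ChainDerivative.

Section Pointwise.
Context {R : realType} {W : vectType R} (sigma : {skew_symmetric W}).
Variables (n : nat) (eps : bool) (I : set R) (Lam : R -> {vspace W}) (k : nat).
Variables (g : R -> R -> R) (lam : 'I_n.+1 -> R -> R).
Hypothesis rk1 : rank1 sigma I Lam.
Hypothesis regular : is_regular_part sigma I Lam k g.
Variables E F : 'I_n.+1 -> R -> W.
Hypothesis frame : forall t, I t ->
    [/\ forall i, [/\ vsmooth_at (E i) t, vsmooth_at (F i) t &
                      smooth_at (lam i) t],
        darboux sigma (E ^~ t) (F ^~ t),
        Lam t = <<[seq E i t | i : 'I_n.+1]>>%VS,
        forall i j : 'I_n.+1, j = i.+1 :> nat -> is_vderive (E i) t (E j t) &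
    [/\ forall i : 'I_n.+1, i.+1 = n.+1 ->
          is_vderive (E i) t ((-1) ^+ eps *: F i t),
        forall i : 'I_n.+1, i = 0%N :> nat ->
          is_vderive (F i) t (lam (rev_ord i) t *: E i t) &
        forall i j : 'I_n.+1, i = j.+1 :> nat ->
          is_vderive (F i) t (lam (rev_ord i) t *: E i t - F j t)]].

(** [lam] with indices extended to [nat], as jets require. *)
Definition natlam j := lam (inord j).

Let chain (v : W) (p : nat) (x : R) : R :=
  if (p <= n)%N then sigma (E (inord p) x) v
  else if (p <= n.*2.+1)%N then kap n eps p * sigma (F (inord (n.*2.+1 - p)) x) v
  else 0.

Let is_derive_sigmal (l : R -> W) (s : R) (d v : W) : is_vderive l s d ->
  is_derive s 1 (fun x => sigma (l x) v) (sigma d v).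
Proof.
move=> /(_ (sigmal sigma v)); rewrite sigmalE.
have -> // : (fun x => sigmal sigma v (l x) : R) = fun x => sigma (l x) v.
by apply/funext => x; rewrite sigmalE.
Qed.

Let kapS p : (n < p)%N -> kap n eps p.+1 = - kap n eps p :> R.
Proof. by move=> np; rewrite /kap subSn// addnS exprS mulN1r. Qed.

Let kap2 p : kap n eps p * kap n eps p = 1 :> R.
Proof. by rewrite -expr2 /kap sqrr_sign. Qed.

Lemma is_derive_frame_chain v s p : I s -> (p <= n.*2.+1)%N ->
  is_derive s 1 (chain v p)
    (chain v p.+1 s + (if (n < p)%N
       then kap n eps p * natlam (p - n.+1) s * chain v (n.*2.+1 - p) s else 0)).
Proof.
move=> Is pn2; have [_ _ _ dE [dEn dF0 dF]] := frame Is.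
have [pn|pn] := ltnP p n.
  have -> : chain v p = fun x => sigma (E (inord p) x) v.
    by apply/funext => x; rewrite /chain ltnW.
  rewrite (ltnNge n p) (ltnW pn) addr0 /chain pn.
  apply: is_derive_sigmal; apply: dE; rewrite !inordK//; lia.
have [pn'|np] := leqP p n.
  have pE : p = n by lia.
  have -> : chain v p = fun x => sigma (E (inord p) x) v.
    by apply/funext => x; rewrite /chain pn'.
  rewrite addr0 /chain ltnNge pn /= (_ : (p < n.*2.+1)%N); last by lia.
  rewrite (_ : kap n eps p.+1 = (-1) ^+ eps); last first.
    by rewrite /kap pE subnn addn0.
  rewrite -sigmaZl (_ : (n.*2.+1 - p.+1)%N = p); last by lia.
  by apply: is_derive_sigmal; apply: dEn; rewrite inordK//; lia.
have -> : chain v p =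
    kap n eps p \*: (fun x => sigma (F (inord (n.*2.+1 - p)) x) v).
  by apply/funext => x; rewrite /chain leqNgt np pn2.
set i : 'I_n.+1 := inord (n.*2.+1 - p).
have iE : i = (n.*2.+1 - p)%N :> nat by rewrite inordK//; lia.
have revi : rev_ord i = inord (p - n.+1).
  by apply: val_inj; rewrite /= iE inordK//; lia.
have -> : chain v (n.*2.+1 - p) s = sigma (E i s) v.
  by rewrite /chain (_ : (n.*2.+1 - p <= n)%N)//; lia.
rewrite /natlam -revi.
have [pE|p2n] := eqVneq p n.*2.+1.
  have -> : chain v p.+1 s = 0.
    rewrite /chain (_ : (p < n)%N = false); last by lia.
    by rewrite (_ : (p < n.*2.+1)%N = false)//; lia.
  rewrite add0r -mulrA -sigmaZl; apply: is_deriveZ.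
  by apply: is_derive_sigmal; apply: dF0; rewrite iE pE subnn.
set j : 'I_n.+1 := inord (n.*2.+1 - p.+1).
have jE : j = (n.*2.+1 - p.+1)%N :> nat by rewrite inordK//; lia.
have -> : chain v p.+1 s = - kap n eps p * sigma (F j s) v.
  rewrite /chain (_ : (p < n)%N = false); last by lia.
  by rewrite (_ : (p < n.*2.+1)%N) ?kapS//; lia.
rewrite mulNr addrC -mulrA -mulrBr -sigmaZl.
have -> : sigma (lam (rev_ord i) s *: E i s) v - sigma (F j s) v =
    sigma (lam (rev_ord i) s *: E i s - F j s) v.
  by rewrite sigmaDl -[- F j s]scaleN1r !sigmaZl mulN1r.
apply: is_deriveZ; apply: is_derive_sigmal; apply: dF.
by rewrite iE jE; lia.
Qed.

Variable t : R.
Hypothesis tI : (I°)%classic t.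

Let oI : open (I°)%classic. Proof. exact: open_interior. Qed.

Let near_I s : (I°)%classic s -> \forall x \near s, (I°)%classic x.
Proof. by move=> Is; exact: open_nbhs_nbhs. Qed.

Let subI s : (I°)%classic s -> I s. Proof. exact: interior_subset. Qed.

Let dlam s j d : (I°)%classic s -> derivable (derive1n d (natlam j)) s 1.
Proof.
move=> /subI Is; have [/(_ (inord j))[_ _ sm] _ _ _ _] := frame Is.
exact: (nbhs_singleton (smooth_at_derivable sm)).
Qed.

Let kappa (j : 'I_n.+1) : R := kap n eps (n.*2.+1 - j).
Let vj (j : 'I_n.+1) : W := kappa j *: E j t.
Let gramh (h : R) : 'M[R]_n.+1 := gram sigma (E ^~ (t + h)) (E ^~ t) kappa.
Let y : nat -> nat -> R := jet natlam t.

Let gramhE h i j : gramh h i j = chain (vj j) i (t + h).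
Proof.
rewrite mxE /chain /vj sigmaZr inord_val.
by have := ltn_ord i; rewrite ltnS => ->.
Qed.

Let chain_t (j : 'I_n.+1) p : (p <= n.*2.+1)%N ->
  chain (vj j) p t = (p == n.*2.+1 - j)%N%:R.
Proof.
move=> pn; have [_ [_ EE _ FE] _ _ _] := frame (subI tI).
have jn := ltn_ord j; rewrite /chain /vj.
have [pn'|np] := leqP p n.
  rewrite sigmaZr EE mulr0; case: eqP => //; lia.
rewrite pn sigmaZr FE mulrCA; case: eqVneq => [pE|pE].
  have -> : p = (n.*2.+1 - j)%N by move/(congr1 val): pE; rewrite /= inordK; lia.
  by rewrite mulr1 /kappa kap2 eqxx.
case: eqP => [jE|_]; last by rewrite !mulr0.
by case/eqP: pE; apply: val_inj; rewrite /= inordK; lia.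
Qed.

(** Against [E_j(t)] only the chain element of index [2n+1-j] survives at time
    [t], so the Taylor coefficients are the [cf] ending there; those of order
    below [2n+1-i-j] have negative weight and vanish. *)
Lemma expands_gram K (i j : 'I_n.+1) :
  expands K (fun h => gramh h i j / h ^+ (n.*2.+1 - i - j)) (gram_poly n eps K y i j).
Proof.
have in_ := ltn_ord i; have jn := ltn_ord j.
set o := (n.*2.+1 - i - j)%N; apply: expands_divX.
pose fs d x := chain_derive n eps natlam (chain (vj j)) i d x.
have dfs : \forall s \near t, forall d, is_derive (s : R) 1 (fs d) (fs d.+1 s).
  apply: filterS (near_I tI) => s Is d.
  have zl : chain (vj j) n.*2.+2 s = 0.
    have nn : (n.*2.+2 <= n)%N = false by lia.
    have nn' : (n.*2.+2 <= n.*2.+1)%N = false by lia.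
    by rewrite /chain nn nn'.
  exact: (is_derive_chain (fun a b _ => @dlam s a b Is)
    (fun p pn => is_derive_frame_chain (vj j) (subI Is) pn) zl).
have fs0 x : fs 0%N x = chain (vj j) i x.
  have i2 : (i < n.*2.+2)%N by lia.
  rewrite /fs /chain_derive (bigD1 (Ordinal i2))//= eqxx mul1r big1 ?addr0// => p pi.
  rewrite (_ : (p == i :> nat) = false) ?mul0r//.
  by apply: contra_neqF pi => /eqP pi; exact: val_inj.
have fst d : fs d t = deval (cf n eps i d (n.*2.+1 - j)) y.
  have q2 : (n.*2.+1 - j < n.*2.+2)%N by lia.
  rewrite /fs /chain_derive (bigD1 (Ordinal q2))//= chain_t ?leq_subr// eqxx mulr1.
  rewrite big1 ?addr0// => p pq; rewrite chain_t; last by rewrite -ltnS.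
  rewrite (_ : (p == _ :> nat) = false) ?mulr0//.
  by apply: contra_neqF pq => /eqP pq; exact: val_inj.
have := taylor_expands (K + o) dfs.
have -> : \poly_(s < K + o) (fs s t / s`!%:R) = 'X^o * gram_poly n eps K y i j.
  apply/polyP => s; rewrite coefXnM [gram_poly _ _ _ _ _ _]mxE !coef_poly fst.
  have [so|os] := ltnP s o.
    have neg : (s + i)%N%:Z - (n.*2.+1 - j)%N%:Z < 0 by rewrite /o in so; lia.
    by rewrite (homog_neg _ (homog_cf n eps i s (n.*2.+1 - j)) neg) mul0r if_same.
  have -> : (s - o < K)%N = (s < K + o)%N by lia.
  by rewrite -/o subnKC.
apply: near_expands; near=> h.
by rewrite gramhE fs0.
Unshelve. all: by end_near. Qed.

Let scaled_gram (h : R) : 'M[R]_n.+1 :=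
  \matrix_(i, j) (gramh h i j / h ^+ (n.*2.+1 - i - j)).

Let expands_scaled K i j :
  expands K (fun h => scaled_gram h i j) (gram_poly n eps K y i j).
Proof. by under eq_fun do rewrite mxE; exact: expands_gram. Qed.

Let scaled_gram_unit : \forall h \near (0 : R)^', scaled_gram h \in unitmx.
Proof.
have : \forall h \near (0 : R)^', \det (scaled_gram h) != 0.
  apply: (@expands_neq0 _ 1 _ (\det (gram_poly n eps 1 y))) => //.
    exact: expands_det (expands_scaled 1).
  rewrite horner_coef0 det_gram_coef0//.
  by have := @fhilb_unit R n; rewrite unitmxE unitfE.
by apply: filterS => h; rewrite unitmxE unitfE.
Qed.

(** The powers of [h] by which the entries of the Gram matrix are divided form
    a matrix of rank one, so that dividing by them amounts to rescaling rows and
    columns. *)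
Let gram_inverse h : h != 0 -> scaled_gram h \in unitmx ->
  gramh h \in unitmx /\
  h * invmx (gramh h) ord_max ord_max = invmx (scaled_gram h) ord_max ord_max.
Proof.
move=> h0 hu.
pose al : 'rV[R]_n.+1 := \row_i h ^+ (n - i).+1.
pose be : 'rV[R]_n.+1 := \row_j h ^+ (n - j).
have gE : gramh h = diag_mx al *m scaled_gram h *m diag_mx be.
  apply/matrixP => i j; rewrite mul_mx_diag mul_diag_mx [RHS]mxE [X in X * _]mxE.
  rewrite [scaled_gram _ _ _]mxE [al _ _]mxE [be _ _]mxE.
  have -> : (n.*2.+1 - i - j)%N = ((n - i).+1 + (n - j))%N.
    by have := ltn_ord i; have := ltn_ord j; lia.
  have : h ^+ ((n - i).+1 + (n - j)) != 0 by rewrite expf_neq0.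
  by rewrite exprD => hij; rewrite mulrAC mulrCA mulfV ?mulr1.
have gu : gramh h \in unitmx.
  rewrite gE !unitmx_mul hu !unitmxE !det_diag !unitfE andbT.
  apply/andP; split; apply/prodf_neq0 => i _; rewrite mxE; exact: expf_neq0.
split=> //.
pose e : 'rV[R]_n.+1 := delta_mx 0 ord_max.
have eE (M : 'M[R]_n.+1) : (e *m M) 0 ord_max = M ord_max ord_max.
  by rewrite -rowE mxE.
pose w := h *: (e *m invmx (gramh h)) *m diag_mx al.
have wE : w *m scaled_gram h = h *: e.
  have eb : e = e *m diag_mx be.
    apply/rowP => j; rewrite mul_mx_diag !mxE eqxx /=.
    by case: eqP => [->|_]; rewrite ?subnn ?expr0 ?mulr1 ?mul0r.
  have bu : diag_mx be \in unitmx.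
    rewrite unitmxE det_diag unitfE; apply/prodf_neq0 => i _.
    by rewrite mxE expf_neq0.
  apply: (can_inj (mulmxK bu)); rewrite -scalemxAl -eb.
  by rewrite /w -!scalemxAl -!mulmxA mulmxA -!mulmxA (mulmxA _ _ (diag_mx be)) -gE mulVmx// mulmx1.
have := congr1 (fun M => (M *m invmx (scaled_gram h)) 0 ord_max) wE.
have wmm : w 0 ord_max = h * invmx (gramh h) ord_max ord_max * h.
  rewrite /w mul_mx_diag mxE; congr (_ * _); first by rewrite mxE eE.
  by rewrite mxE subnn expr1.
rewrite /= mulmxK// -scalemxAl [X in _ = X]mxE eE wmm mulrC => /(mulfI h0).
exact.
Qed.

Let near_t (P : set R) : (\forall s \near t, P s) -> \forall h \near (0 : R)^', P (t + h).
Proof.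
move=> tP; apply: nbhs_dnbhs.
have ct : {for 0, continuous (fun h : R => t + h)}.
  by apply: continuousD; [exact: cst_continuous|exact: cvg_id].
by apply: ct; rewrite /= addr0.
Qed.

Let velE s : (I°)%classic s -> forall u v, velocity sigma Lam s u v =
  (-1) ^+ eps * (sigma (F ord_max s) (vsval u) * sigma (F ord_max s) (vsval v)).
Proof.
move=> Is; have [_ _ _ dE [dEn _ _]] := frame (subI Is).
apply: (velocity_frame (E := E)) => //; last exact: rk1 (subI Is).
  by apply: filterS (near_I Is) => x /subI Ix; have [_ ? ? _ _] := frame Ix.
exact: dEn.
Qed.

(** Cleared of denominators, the value of the cross-ratio involves only
    functions of [h] with known expansions. *)
Let trace_identity : \forall h \near (0 : R)^',
  (k%:R + h ^+ 2 * g (t + h) t) * \det (scaled_gram h) ^+ 2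
    = (\adj (scaled_gram h) ord_max ord_max) ^+ 2.
Proof.
have [_ reg] := regular (subI tI).
have ct : (s, t) @[s --> t] --> ((t, t) : R * R).
  by apply: (@cvg_pair _ _ _ _ (nbhs t) (nbhs t)); [exact: cvg_id|exact: cvg_cst].
have reg1 : \forall s \near t, I s -> I t -> s != t -> (Lam s :&: Lam t = 0)%VS ->
    lftrace (cross_ratio sigma (velocity sigma Lam s) (velocity sigma Lam t)) =
    - (k%:R / (s - t) ^+ 2) - g s t.
  exact: ct _ reg.
have reg2 := near_t reg1; have nearI := near_t (near_I tI).
near=> h.
have h0 : h != 0 by near: h; exact: nbhs_dnbhs_neq.
have hI : (I°)%classic (t + h) by near: h.
have su : scaled_gram h \in unitmx by near: h; exact: scaled_gram_unit.
have [gu ginv] := gram_inverse h0 su.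
have [_ fr1 L1 _ _] := frame (subI tI); have [_ fr0 L0 _ _] := frame (subI hI).
have kk j : kappa j * kappa j = 1 by exact: kap2.
have regh : I (t + h) -> I t -> t + h != t -> (Lam (t + h) :&: Lam t = 0)%VS ->
    lftrace (cross_ratio sigma (velocity sigma Lam (t + h)) (velocity sigma Lam t)) =
    - (k%:R / (t + h - t) ^+ 2) - g (t + h) t by near: h.
have ht : t + h != t by rewrite -subr_eq0 addrAC subrr add0r.
have := regh (subI hI) (subI tI) ht (gram_transversal fr0 fr1 L0 L1 gu).
have s2 : (-1) ^+ eps * (-1) ^+ eps = 1 :> R by rewrite -expr2 sqrr_sign.
rewrite (lftrace_cross_ratio fr0 fr1 L0 L1 kk gu s2 (velE hI) (velE tI)).
rewrite addrAC subrr add0r => tr.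
have -> : \adj (scaled_gram h) ord_max ord_max
    = \det (scaled_gram h) * (h * invmx (gramh h) ord_max ord_max).
  have -> : h * invmx (gramh h) ord_max ord_max
      = (\det (scaled_gram h))^-1 * \adj (scaled_gram h) ord_max ord_max.
    by rewrite ginv /invmx su mxE.
  rewrite mulVKf//.
  by move: su; rewrite unitmxE unitfE.
rewrite !exprMn [RHS]mulrC; congr (_ * _).
have -> : invmx (gramh h) ord_max ord_max ^+ 2 = k%:R / h ^+ 2 + g (t + h) t.
  by apply: oppr_inj; rewrite tr opprD.
by rewrite mulrDr mulrCA mulfV ?mulr1// expf_neq0.
Unshelve. all: by end_near. Qed.

(** Both sides are the series of [h ^+ 2] times minus the trace at the times
    [t + h] and [t]: one by definition of the [beta g i], the other by
    [nu_sq_unique]. *)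
Lemma beta_nu K s : (s < K)%N ->
  ((k%:R)%:P + 'X^2 * \poly_(i < K) beta g i t)`_s
    = ((nu n eps K y 0 ord_max) ^+ 2)`_s.
Proof.
move=> sK; have K0 : (0 < K)%N by case: K sK.
apply: (nu_sq_unique K0) sK; apply: (@expands_unique _ K
    (fun h => (k%:R + h ^+ 2 * g (t + h) t) * \det (scaled_gram h) ^+ 2)).
  rewrite !expr2; apply: expandsM; last first.
    by apply: expandsM; apply: expands_det; exact: expands_scaled.
  apply: expandsD; first exact: expandsC.
  apply: expandsM; last first.
    have [gsm _] := regular (subI tI).
    apply: (@taylor_expands _ (fun i s => derive1n i (fun s => g s t) s)).
    apply: filterS (derivable_slice gsm) => x dg d.
    by apply: DeriveDef => //; rewrite derive1nS derive1E.
  have -> : (fun h : R => h * h) = horner ('X * 'X).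
    by apply/funext => h; rewrite hornerM !hornerX.
  exact: expands_poly.
apply: near_expands (_ : expands K (fun h => \adj (scaled_gram h) ord_max ord_max ^+ 2) _).
  by apply: filterS trace_identity => h ->.
rewrite !expr2; apply: expandsM; exact: expands_adj (expands_scaled K).
Qed.

Lemma beta_even_nu r K : (r.*2.+2 < K)%N ->
  beta g r.*2 t = ((nu n eps K y 0 ord_max) ^+ 2)`_(r.*2.+2).
Proof.
move=> rK; rewrite -beta_nu// coefD coefC /= add0r coefXnM /= coef_poly.
by rewrite subSS subSS subn0 (ltn_trans _ rK).
Qed.

End Pointwise.
(** * The theorem *)

Section Closing.
Context {R : realType}.

(** Endpoints of the interval are reached by continuity from the interior, where
    the curve is defined on both sides. *)
Lemma interior_interval_dense (I : set R) t (A : set R) :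
  proper_interval I -> I t -> nbhs t A -> exists2 s, A s & (I°)%classic s.
Proof.
move=> [itvI [c cI]] It /nbhs_ballP[e /= e0 eA].
have cI' : I c by exact: interior_subset.
have [ct|tc] := eqVneq c t.
  by exists c => //; apply: eA; rewrite ct; exact: ballxx.
pose d := Num.min (1 / 2) (e / (2 * `|c - t|)).
pose s := t + d * (c - t).
have ct0 : 0 < `|c - t| by rewrite normr_gt0 subr_eq0.
have d0 : 0 < d by rewrite lt_min !divr_gt0// mulr_gt0.
have d1 : d < 1 by rewrite gt_min; apply/orP; left; lra.
exists s.
  apply: eA; rewrite /ball /= /s opprD addrA subrr sub0r normrN normrM gtr0_norm//.
  rewrite -ltr_pdivlMr// gt_min; apply/orP; right.
  by rewrite ltr_pM2l// ltf_pV2 ?posrE ?mulr_gt0//; lra.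
have between x y : I x -> I y -> x < s < y -> (I°)%classic s.
  move=> Ix Iy xsy; apply: filterS (near_in_itvoo xsy) => z.
  rewrite in_itv /= => /andP[xz zy]; apply: (itvI x y) => //.
  by rewrite !ltW.
have [ct|ct|/eqP] := ltgtP c t; last by rewrite (negbTE tc).
  apply: (between c t) => //; rewrite /s; nra.
apply: (between t c) => //; rewrite /s; nra.
Qed.

End Closing.

Theorem proposition2 (R : realType) (m : nat) (eps : bool) :
  exists (C : 'I_m -> R) (N : nat) (P : forall i : 'I_m, diff_poly R i N),
    (forall i, C i != 0) /\
    (forall i, no_free_term (P i)) /\
    forall (W : vectType R) (sigma : {skew_symmetric W}),
      symplectic_space sigma m ->
    forall (I : set R) (Lam : R -> {vspace W}) (k : nat),
      proper_interval I ->
      smooth_lagrangian_curve (m := m) sigma I Lam ->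
      rank1 sigma I Lam ->
      monotone_type sigma eps I Lam ->
      constant_weight (m := m) sigma I Lam k ->
    forall (g : R -> R -> R) (lam : 'I_m -> R -> R),
      is_regular_part sigma I Lam k g ->
      modified_curvatures sigma eps I Lam lam ->
    forall (i : 'I_m) (t : R), I t ->
      lam i t = C i * beta g i.*2 t
                + diff_eval (P i) (fun j => beta g j.*2) t.
Proof.
case: m => [|n].
  exists (fun=> 1), 0%N, (fun i => dmpoly i 0 (DCst 0)).
  by split=> [[]//|]; split=> [[]//|? ? ? ? ? ? ? ? ? ? ? ? ? ? ? []].
have /choice[Tc hTc] : forall r : nat, exists ec : dexp R * R, (r < n.+1)%N ->
    [/\ ec.2 != 0, dvars_lt r ec.1, deval ec.1 (fun _ _ => 0) = 0 &
    forall y, ((nu n eps r.*2.+3 y 0 ord_max) ^+ 2)`_(r.*2.+2) = deval ec.1 y + ec.2 * y r 0%N].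
  move=> r; have [rn|] := ltnP r n.+1; last by exists (DCst 0, 0).
  have [e [c ec]] := @nu_sq_expansion R n eps r.*2.+3 isT r rn (ltnSn _).
  by exists (e, c).
pose T r := (Tc r).1; pose c r := (Tc r).2.
have [|S [hS invS]] := @triangular_inversion R T c n.+1.
  by move=> r rn; have [] := hTc r rn.
pose N := \max_(r < n.+1) dorder (S r).
exists (fun i => (c i)^-1), N, (fun i => dmpoly i N (S i)); split.
  by move=> i; rewrite invr_eq0; have [] := hTc i (ltn_ord i).
split=> [i|].
  by apply: no_free_term_dmpoly; have [] := hS i (ltn_ord i).
move=> W sigma _ I Lam k propI _ rk _ _ g lam reg [E [F frame]] i t It.
pose b j := beta g j.*2.
have bder s : I s -> \forall x \near s, forall j d, derivable (derive1n d (b j)) x 1.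
  move=> Is; have [gsm _] := reg s Is.
  by apply: filterS (derivable_beta gsm) => x gx j d; exact: gx.
rewrite diff_eval_dmpoly; [|exact: (hS i (ltn_ord i)).1|]; last first.
  exact: (leq_bigmax i).
have interior_eq s : (I°)%classic s ->
    lam i s = (c i)^-1 * b i s + deval (S i) (jet b s).
  move=> Is; have -> : lam i s = natlam lam i s by rewrite /natlam inord_val.
  apply: (invS (I°)%classic) => //; first exact: open_interior.
    move=> r d x rn /interior_subset Ix; exact: (nbhs_singleton (bder x Ix)).
  move=> r x rn Ix; have [_ _ _ <-] := hTc r rn.
  exact: (beta_even_nu rk reg frame Ix).
(* At an endpoint of [I] the frame equations hold on one side only; the
   difference of the two members is continuous there and zero in the interior. *)
pose D s := lam i s - ((c i)^-1 * b i s + deval (S i) (jet b s)).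
have Dder : derivable D t 1.
  have [/(_ i)[_ _ lsm] _ _ _ _] := frame t It.
  have dl : derivable (lam i) t 1 := nbhs_singleton (smooth_at_derivable lsm) 0%N.
  have db := nbhs_singleton (bder t It).
  have dS : derivable (fun s => deval (S i) (jet b s)) t 1.
    by have [] := @is_derive_deval R (S i) i b t (fun j d _ => db j d) (hS i (ltn_ord i)).1.
  apply: derivableB => //; apply: derivableD => //.
  apply: derivableM; [exact: derivable_cst|exact: db i 0%N].
have Dcont : {for t, continuous D}.
  exact/differentiable_continuous/derivable1_diffP.
apply/eqP; rewrite -subr_eq0; apply/negPn/negP => Dt.
have : \forall s \near t, D s != 0 by exact: (cvgr_neq0 _ Dcont).
move=> /(interior_interval_dense propI It)[s Ds /interior_eq Es].
by move: Ds; rewrite /D Es subrr eqxx.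
Qed.
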